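(* In the New Keynesian model with fairness described in the context, log-linearized around a steady state with $\overline{M^p}<M^h$, the short-run Phillips curve is $$(1-\delta\gamma)\,\widehat{m^p}(t)-\lambda_1\,\widehat{n}(t)=\delta\gamma\,\mathbb{E}_t[\widehat{\pi}(t+1)]-\lambda_2\,\mathbb{E}_t[\widehat{n}(t+1)],$$ where $$\lambda_1=(1+\eta)\,\frac{\varepsilon+(\varepsilon-1)\gamma\overline{\phi}}{\gamma\,\overline{\phi}\,\overline{\sigma}}\left[1+\frac{(1-\delta)\gamma}{1-\delta\gamma}\overline{\phi}\right],\qquad \lambda_2=(1+\eta)\,\delta\,\frac{\varepsilon+(\varepsilon-1)\overline{\phi}}{\overline{\phi}\,\overline{\sigma}}\left[1+\frac{(1-\delta)\gamma}{1-\delta\gamma}\overline{\phi}\right].$$ Accordingly, the short-run Phillips curve is hybrid, including both past and future inflation rates: $$(1-\delta\gamma)\sum_{s=0}^{\infty}\gamma^{s+1}\,\widehat{\pi}(t-s)-\lambda_1\,\widehat{n}(t)=\delta\gamma\,\mathbb{E}_t[\widehat{\pi}(t+1)]-\lambda_2\,\mathbb{E}_t[\widehat{n}(t+1)].$$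
   Context: Model. Firms $j\in[0,1]$, households $k\in[0,1]$, discrete time $t$, conditional expectation $\mathbb{E}_t$. Parameters: $\varepsilon>1$, $\nu>1$, $\gamma\in(0,1)$, $\delta\in(0,1)$, $\eta>0$, $\alpha\in(0,1]$, $\psi>1$. Perceptions and fairness. Households do not observe marginal costs; the perceived marginal cost of firm $j$ obeys $C^p_j(t)=[C^p_j(t-1)]^{\gamma}\left[\frac{\varepsilon-1}{\varepsilon}P_j(t)\right]^{1-\gamma}$, and the perceived markup is $M^p_j(t)=P_j(t)/C^p_j(t)$. The fairness factor is $F_j(t)=F(M^p_j(t))$, where $F$ is twice differentiable, strictly decreasing and weakly concave on $[0,M^h]$, $F>0$ on $[0,M^h)$, $F(M^h)=0$, $M^h>\varepsilon/(\varepsilon-1)$. Let $\phi=-\frac{d\ln F}{d\ln M^p}$ and $\sigma=\frac{d\ln \phi}{d\ln M^p}$. Households. With $Z_{jk}(t)=F_j(t)Y_{jk}(t)$ and $Z_k(t)=\left[\int_0^1 Z_{jk}(t)^{(\varepsilon-1)/\varepsilon}dj\right]^{\varepsilon/(\varepsilon-1)}$, household $k$ maximizes $\mathbb{E}_0\sum_{t\ge0}\delta^t\left[\ln Z_k(t)-\frac{N_k(t)^{1+\eta}}{1+\eta}\right]$ by choosing purchases $Y_{jk}(t)$, labor $N_k(t)$, wage $W_k(t)$ and bonds $B_k(t)$, subject to $\int_0^1P_j(t)Y_{jk}(t)dj+Q(t)B_k(t)=W_k(t)N_k(t)+B_k(t-1)+V_k(t)$ (with $V_k$ dividends), a no-Ponzi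 constraint, and firms' demand for labor service $k$; it takes fairness factors, prices and dividends as given. The price index is $X(t)=\left\{\int_0^1[P_j(t)/F_j(t)]^{1-\varepsilon}dj\right\}^{1/(1-\varepsilon)}$, and the resulting aggregate demand for good $j$ is $Y^d_j(t)=Z(t)\left[\frac{P_j(t)}{X(t)}\right]^{-\varepsilon}F\!\left(\left(\frac{\varepsilon}{\varepsilon-1}\right)^{1-\gamma}\left[\frac{P_j(t)}{C^p_j(t-1)}\right]^{\gamma}\right)^{\varepsilon-1}$ with $Z(t)=\int_0^1 Z_k(t)dk$. Firms. Firm $j$ produces $Y_j(t)=A_j(t)N_j(t)^{\alpha}$ with $N_j(t)=\left[\int_0^1N_{jk}(t)^{(\nu-1)/\nu}dk\right]^{\nu/(\nu-1)}$. It chooses $Y_j(t),P_j(t),N_{jk}(t)$ to maximize $\mathbb{E}_0\sum_{t\ge0}\Gamma(t)\left[P_j(t)Y_j(t)-\int_0^1W_k(t)N_{jk}(t)dk\right]$ subject to the production function, the demand $Y_j^d$ (taking $Z,X$ as given), and the law of motion of $C^p_j$ (which it internalizes); the stochastic discount factor is $\Gamma(t)=\delta^t\frac{X(0)Z(0)}{X(t)Z(t)}$. Its nominal marginal cost is $C_j(t)=W(t)/[\alpha A_j(t)N_j(t)^{\alpha-1}]$, with $W(t)=\left[\int_0^1W_k(t)^{1-\nu}dk\right]^{1/(1-\nu)}$, and its markup is $M_j(t)=P_j(t)/C_j(t)$. Monetary policy. $i(t)=i_0(t)+\psi\,\pi(t)$ with $i(t)=-\ln Q(t)$, $\pi(t)=\ln(P(t)/P(t-1))$,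 $i_0(t)$ exogenous. Equilibrium. The economy is symmetric (same endowments, dividends, technology $A(t)$, fairness function and initial perceived costs), so subscripts are dropped; goods, labor and bond markets clear; agents' choices satisfy the first-order conditions of their (Lagrangian) problems. In a steady state real variables (and $A$, $i_0$) are constant and nominal variables grow at a constant inflation rate $\overline{\pi}$. Notation. $\overline{H}$ is the steady-state value of $H(t)$; $\widehat{h}(t)=\ln H(t)-\ln\overline{H}$ (so $\widehat n$, $\widehat{m^p}$ are log-deviations of $N$, $M^p$); $\widehat{\pi}(t)=\pi(t)-\overline{\pi}$; $\overline{\phi}=\phi(\overline{M^p})$, $\overline{\sigma}=\sigma(\overline{M^p})$. Log-linearized equilibrium: each equilibrium condition is replaced by its first-order expansion in these deviations around the steady state (expectations being applied to the first-order expansions). For the infinite-sum form, the process is considered for all past dates with $\widehat{m^p}$ bounded. *)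

(* Defs.v *)
From HB Require Import structures.
From mathcomp Require Import all_boot all_order all_algebra.
From mathcomp Require Import all_classical all_reals all_analysis.

Set Implicit Arguments.
Unset Strict Implicit.
Unset Printing Implicit Defensive.

Import Order.TTheory GRing.Theory Num.Theory.
Import numFieldNormedType.Exports.

Local Open Scope classical_set_scope.
Local Open Scope ring_scope.

(* [f'] is the derivative of [f] on the segment [a, b], one-sided at the end
   points; the values of [f] outside the segment are irrelevant. *)
Definition derivative_on_segment {R : realType} (a b : R) (f f' : R -> R) : Prop :=
  forall m : R, a <= m <= b ->
    (fun y : R => (f y - f m) / (y - m))
      @ within [set y : R | a <= y <= b /\ y != m] (nbhs m) --> f' m.

Definition twice_differentiable_on_segment {R : realType} (a b : R) (f : R -> R)
    : Prop :=
  exists f1 f2 : R -> R,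
    derivative_on_segment a b f f1 /\ derivative_on_segment a b f1 f2.

(* d ln f / d ln M at M *)
Definition elasticity {R : realType} (f : R -> R) (M : R) : R :=
  derive1 (fun u : R => ln (f (expR u))) (ln M).

Record economy (R : realType) := Economy {
  eps : R;
  nu : R;
  gam : R;
  delta : R;
  eta : R;
  alpha : R;
  psi : R;
  Fair : R -> R;
  Mh : R;
  eps_gt1 : 1 < eps;
  nu_gt1 : 1 < nu;
  gam_in01 : 0 < gam < 1;
  delta_in01 : 0 < delta < 1;
  eta_gt0 : 0 < eta;
  alpha_in01 : 0 < alpha <= 1;
  psi_gt1 : 1 < psi;
  Mh_gt : eps / (eps - 1) < Mh;
  Fair_diff2 : twice_differentiable_on_segment 0 Mh Fair;
  Fair_decr : forall a b : R, 0 <= a -> a < b -> b <= Mh -> Fair b < Fair a;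
  Fair_concave : forall a b s : R,
    0 <= a <= Mh -> 0 <= b <= Mh -> 0 <= s <= 1 ->
    s * Fair a + (1 - s) * Fair b <= Fair (s * a + (1 - s) * b);
  Fair_gt0 : forall a : R, 0 <= a < Mh -> 0 < Fair a;
  Fair_Mh : Fair Mh = 0
}.

Definition phi {R : realType} (e : economy R) (M : R) : R :=
  - elasticity (Fair e) M.

Definition sigma {R : realType} (e : economy R) (M : R) : R :=
  elasticity (phi e) M.

(* The common (symmetric) values of the date-t variables. *)
Inductive var : Set :=
| Output        (* Y, also household purchases Y_jk *)
| Labor         (* N, also N_k and N_jk *)
| Price         (* P *)
| Wage          (* W, also W_k *)
| PercCost      (* C^p *)
| PercMarkup    (* M^p *)
| MargCost      (* C *)
| Markup        (* M *)
| Fairness      (* the fairness factor F(M^p) *)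
| PriceIndex    (* X *)
| Consumption   (* Z, also Z_k *)
| Bonds         (* B *)
| BondPrice     (* Q *)
| Dividends     (* V *)
| Technology    (* A *)
| Inflation     (* pi *)
| Interest      (* i *)
| PolicyShock   (* i_0 *)
| MultBudget    (* household multiplier on the budget constraint *)
| MultLaborDem  (* household multiplier on the labor-demand constraint *)
| MultDemand    (* firm multiplier on the demand for its good *)
| MultProd      (* firm multiplier on the production function *)
| MultPerc.     (* firm multiplier on the law of motion of C^p *)

Definition var_eq_dec (u v : var) : {u = v} + {u <> v}.
Proof. by decide equality. Defined.

HB.instance Definition _ := hasDecEq.Build var (compareP var_eq_dec).

(* A sequence of values of all variables, indexed by calendar time. *)
Definition trajectory (R : realType) := int -> var -> R.

Definition set_at {R : realType} (y : trajectory R) (t : int) (v : var) (z : R) : trajectory R :=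
  fun t' v' => if (t' == t) && (v' == v) then z else y t' v'.

(* Integral over a continuum of firms or households. *)
Definition int01 {R : realType} (f : R -> R) : R :=
  \int[@lebesgue_measure R]_(j in `[0, 1]) f j.

Definition ces {R : realType} (r : R) (f : R -> R) : R :=
  (int01 (fun j => f j `^ r)) `^ r^-1.

(* A constant profile [a] over the continuum, shifted by [z] on the set [D]. *)
Definition shift_on {R : realType} (D : set R) (a z : R) : R -> R :=
  fun j => a + z * \1_D j.

Definition law_of_motion {R : realType} (e : economy R) (c p : R) : R :=
  c `^ gam e * ((eps e - 1) / eps e * p) `^ (1 - gam e).

(* Y^d_j(t) at own price [p] and own lagged perceived cost [c]; the
   aggregates Z(t) and X(t) are those of [x]. *)
Definition goods_demand {R : realType} (e : economy R) (x : trajectory R) (t : int)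
    (p c : R) : R :=
  x t Consumption * (p / x t PriceIndex) `^ (- eps e)
  * Fair e ((eps e / (eps e - 1)) `^ (1 - gam e) * (p / c) `^ gam e)
      `^ (eps e - 1).

(* Firms' cost-minimizing demand for one labor service at wage [w], given
   aggregate employment and the wage index in [x]. *)
Definition labor_demand {R : realType} (e : economy R) (x : trajectory R) (t : int)
    (w : R) : R :=
  x t Labor * (w / x t Wage) `^ (- nu e).

(* In both Lagrangians below, [x] carries what the agent takes as given and
   [y] the agent's own choices and multipliers; they coincide in a symmetric
   equilibrium. Choices that are profiles over the continuum (purchases [c],
   hired labor services [l]) are separate arguments. *)

Definition household_term {R : realType} (e : economy R) (x y : trajectory R)
    (c : int -> R -> R) (t : int) : R :=
  ln (ces ((eps e - 1) / eps e) (fun j => x t Fairness * c t j))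
  - y t Labor `^ (1 + eta e) / (1 + eta e)
  + y t MultBudget *
      (y t Wage * y t Labor + y (t - 1) Bonds + x t Dividends
       - int01 (fun j => x t Price * c t j) - x t BondPrice * y t Bonds)
  + y t MultLaborDem * (labor_demand e x t (y t Wage) - y t Labor).

Definition firm_term {R : realType} (e : economy R) (x y : trajectory R)
    (l : int -> R -> R) (t : int) : R :=
  y t Price * y t Output - int01 (fun k => x t Wage * l t k)
  + y t MultDemand *
      (goods_demand e x t (y t Price) (y (t - 1) PercCost) - y t Output)
  + y t MultProd *
      (x t Technology * ces ((nu e - 1) / nu e) (l t) `^ alpha e - y t Output)
  + y t MultPerc *
      (law_of_motion e (y (t - 1) PercCost) (y t Price) - y t PercCost).

(* Gamma(t + n) / Gamma(t) *)
Definition sdf {R : realType} (e : economy R) (x : trajectory R) (t : int) (n : nat) : R :=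
  delta e ^+ n * ((x t PriceIndex * x t Consumption)
                  / (x (t + n%:Z) PriceIndex * x (t + n%:Z) Consumption)).

(* Date-t choices enter only the terms of dates t and t+1 of the infinite-horizon
   Lagrangians, so these two-term sums, in date-t value, determine the
   first-order conditions for date-t choices. *)
Definition household_lagrangian {R : realType} (e : economy R) (x : trajectory R)
    (t : int) (y : trajectory R) (c : int -> R -> R) : R :=
  \sum_(n < 2) delta e ^+ n * household_term e x y c (t + (n : nat)%:Z).

Definition firm_lagrangian {R : realType} (e : economy R) (x : trajectory R)
    (t : int) (y : trajectory R) (l : int -> R -> R) : R :=
  \sum_(n < 2) sdf e x t n * firm_term e x y l (t + (n : nat)%:Z).

(* Partial derivatives of the Lagrangians with respect to date-t choices,
   evaluated at the symmetric allocation [x]. For the profiles the derivative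
   is taken for a change on a set [D] of goods or of labor services. *)
Definition household_foc {R : realType} (e : economy R) (v : var) (t : int)
    (x : trajectory R) : R :=
  derive1 (fun z : R => household_lagrangian e x t (set_at x t v z)
                          (fun t' _ => x t' Output)) (x t v).

Definition purchase_foc {R : realType} (e : economy R) (D : set R) (t : int)
    (x : trajectory R) : R :=
  derive1 (fun z : R => household_lagrangian e x t x
     (fun t' => shift_on D (x t' Output) (if t' == t then z else 0))) 0.

Definition firm_foc {R : realType} (e : economy R) (v : var) (t : int)
    (x : trajectory R) : R :=
  derive1 (fun z : R => firm_lagrangian e x t (set_at x t v z)
                          (fun t' _ => x t' Labor)) (x t v).

Definition hiring_foc {R : realType} (e : economy R) (D : set R) (t : int)
    (x : trajectory R) : R :=
  derive1 (fun z : R => firm_lagrangian e x t x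
     (fun t' => shift_on D (x t' Labor) (if t' == t then z else 0))) 0.

(* [optimality e t g]: E_t [g x] = 0 is one of the agents' first-order
   conditions at date t. Derivatives in the multipliers are the constraints. *)
Inductive optimality {R : realType} (e : economy R) (t : int) :
    (trajectory R -> R) -> Prop :=
| opt_household (v : var) of
    v \in [:: Labor; Wage; Bonds; MultBudget; MultLaborDem] :
    optimality e t (household_foc e v t)
| opt_purchase (D : set R) of measurable D & D `<=` `[0, 1] :
    optimality e t (purchase_foc e D t)
| opt_firm (v : var) of
    v \in [:: Output; Price; PercCost; MultDemand; MultProd; MultPerc] :
    optimality e t (firm_foc e v t)
| opt_hiring (D : set R) of measurable D & D `<=` `[0, 1] :
    optimality e t (hiring_foc e D t).

(* [identity e t g]: g x = 0 is one of the remaining equilibrium conditions at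
   date t. Goods and labor market clearing are built into the use of a single
   variable for quantities demanded and supplied. *)
Inductive identity {R : realType} (e : economy R) (t : int) :
    (trajectory R -> R) -> Prop :=
| id_perceived_markup :
    identity e t (fun x => x t PercMarkup - x t Price / x t PercCost)
| id_fairness :
    identity e t (fun x => x t Fairness - Fair e (x t PercMarkup))
| id_price_index :
    identity e t (fun x =>
      x t PriceIndex - ces (1 - eps e) (fun=> x t Price / x t Fairness))
| id_consumption :
    identity e t (fun x => x t Consumption -
      int01 (fun=> ces ((eps e - 1) / eps e)
                       (fun=> x t Fairness * x t Output)))
| id_wage_index :
    identity e t (fun x => x t Wage - ces (1 - nu e) (fun=> x t Wage))
| id_marginal_cost :
    identity e t (fun x => x t MargCost -
      x t Wage / (alpha e * x t Technology * x t Labor `^ (alpha e - 1)))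
| id_markup :
    identity e t (fun x => x t Markup - x t Price / x t MargCost)
| id_dividends :
    identity e t (fun x => x t Dividends -
      int01 (fun=> x t Price * x t Output - int01 (fun=> x t Wage * x t Labor)))
| id_bond_market :
    identity e t (fun x => int01 (fun=> x t Bonds))
| id_interest :
    identity e t (fun x => x t Interest + ln (x t BondPrice))
| id_inflation :
    identity e t (fun x => x t Inflation - ln (x t Price / x (t - 1) Price))
| id_policy :
    identity e t (fun x =>
      x t Interest - (x t PolicyShock + psi e * x t Inflation)).

(* Variables whose deviations are taken in levels: rates, and bond holdings
   (zero in equilibrium). All others are positive, with log-deviations. *)
Definition in_levels (v : var) : bool :=
  v \in [:: Bonds; Inflation; Interest; PolicyShock].

(* Degree of a variable in the unit of account: 1 if nominal, 0 if real. The
   marginal utility of money is of degree -1, while the multiplier on the law of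
   motion of C^p is money per unit of nominal cost, hence real. *)
Definition nominal_degree (v : var) : int :=
  match v with
  | Price | Wage | PercCost | MargCost | PriceIndex | Bonds | Dividends
  | MultDemand | MultProd => 1
  | MultBudget => -1
  | _ => 0
  end.

Definition steady_state {R : realType} (e : economy R) (pibar : R)
    (xbar : trajectory R) : Prop :=
  [/\ forall t v, ~~ in_levels v -> 0 < xbar t v,
      forall t v, xbar t v
        = xbar 0 v * expR ((nominal_degree v)%:~R * pibar * t%:~R),
      forall t, xbar t Inflation = pibar &
      forall t g, optimality e t g \/ identity e t g -> g xbar = 0].

(* Stochastic processes for all variables. *)
Definition process (R : realType) (Omega : Type) := int -> var -> Omega -> R.

Definition deviation {R : realType} {Omega : Type} (xbar : trajectory R)
    (x : process R Omega) : process R Omega :=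
  fun t v w => if in_levels v then x t v w - xbar t v
               else ln (x t v w) - ln (xbar t v).

Definition displaced {R : realType} (xbar h : trajectory R) (s : R) : trajectory R :=
  fun t v => if in_levels v then xbar t v + s * h t v
             else xbar t v * expR (s * h t v).

(* First-order expansion at [xbar] of [g], in the deviations [h]. *)
Definition first_order {R : realType} (xbar : trajectory R) (g : trajectory R -> R)
    (h : trajectory R) : R :=
  derive1 (fun s : R => g (displaced xbar h s)) 0.

Definition measurable_wrt {R : realType} {Omega : Type}
    (G : set (set Omega)) (X : Omega -> R) : Prop :=
  forall B : set R, measurable B -> G (X @^-1` B).

Definition filtration {d : measure_display} {Omega : measurableType d}
    (Fil : int -> set (set Omega)) : Prop :=
  [/\ forall t, sigma_algebra setT (Fil t),
      forall t, Fil t `<=` measurable &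
      forall s t : int, s <= t -> Fil s `<=` Fil t].

(* [E t X] is a version of the conditional expectation of [X] given [Fil t],
   for every integrable [X]. *)
Definition conditional_expectations {R : realType} {d : measure_display}
    {Omega : measurableType d} (Pr : probability Omega R)
    (Fil : int -> set (set Omega)) (E : int -> (Omega -> R) -> Omega -> R) : Prop :=
  forall t (X : Omega -> R), Pr.-integrable setT (EFin \o X) ->
    [/\ measurable_wrt (Fil t) (E t X),
        Pr.-integrable setT (EFin \o E t X) &
        forall A, Fil t A ->
          (\int[Pr]_(w in A) (E t X w)%:E = \int[Pr]_(w in A) (X w)%:E)%E].

Definition admissible {R : realType} {d : measure_display}
    {Omega : measurableType d} (Pr : probability Omega R)
    (Fil : int -> set (set Omega)) (xbar : trajectory R) (x : process R Omega) : Prop :=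
  [/\ forall t v w, ~~ in_levels v -> 0 < x t v w,
      forall t v, measurable_wrt (Fil t) (x t v) &
      forall t v, Pr.-integrable setT (EFin \o deviation xbar x t v)].

(* The date-t conditions of the log-linearized equilibrium. *)
Definition loglinear_equilibrium_at {R : realType} {d : measure_display}
    {Omega : measurableType d} (Pr : probability Omega R)
    (E : int -> (Omega -> R) -> Omega -> R) (e : economy R)
    (xbar : trajectory R) (x : process R Omega) (t : int) : Prop :=
  let expansion (g : trajectory R -> R) (w : Omega) :=
    first_order xbar g (fun t' v => deviation xbar x t' v w) in
  (forall g, identity e t g -> {ae Pr, forall w, expansion g w = 0}) /\
  (forall g, optimality e t g -> {ae Pr, forall w, E t (expansion g) w = 0}).

Definition lambda1 {R : realType} (e : economy R) (Mp : R) : R :=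
  (1 + eta e) *
  ((eps e + (eps e - 1) * gam e * phi e Mp) / (gam e * phi e Mp * sigma e Mp)) *
  (1 + (1 - delta e) * gam e / (1 - delta e * gam e) * phi e Mp).

Definition lambda2 {R : realType} (e : economy R) (Mp : R) : R :=
  (1 + eta e) * delta e *
  ((eps e + (eps e - 1) * phi e Mp) / (phi e Mp * sigma e Mp)) *
  (1 + (1 - delta e) * gam e / (1 - delta e * gam e) * phi e Mp).

(* Main.v *)
(* Write kappa, omega, chi for the firm's multipliers on demand, production and
   the law of motion of C^p. Every first-order condition except the one for C^p
   involves only variables known at date t, so its expansion vanishes almost
   surely. Labor supply, purchases, hiring and production give
   omega - p = (1 + eta) n in log-deviations, the output condition
   P = kappa + omega turns this into kappa - p, and the price condition then
   expresses chi through n and m^p at each date. Substituting at dates t and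
   t + 1 into the condition for C^p, together with the law of motion
   m^p(t+1) = gamma (pi(t+1) + m^p(t)), leaves a multiple of the Phillips curve
   inside E_t. Strict monotonicity and concavity of F give phi > 0 and
   sigma > 0, so that the multiple is nonzero. Iterating the law of motion
   backwards with m^p bounded gives the hybrid form. *)

Require Import Defs.
From HB Require Import structures.
From mathcomp Require Import all_boot all_order all_algebra.
From mathcomp Require Import all_classical all_reals all_analysis.
From mathcomp Require Import ring lra.

Import Order.TTheory GRing.Theory Num.Theory.
Import numFieldNormedType.Exports.

Local Open Scope classical_set_scope.
Local Open Scope ring_scope.

(** * Conditional expectation *)

(** [E t] picks some version of the conditional expectation separately for each variable, so neither
    linearity nor invariance under almost sure equality is built in; both come from almost sure
    uniqueness of versions. The algebra is therefore done path by path, and [E t] is split over a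
    sum only at the very end. The bracket in [lambda1] and [lambda2] is a steady-state ratio. With K
    = kappa Y / P and U = chi C^p / P, the condition for C^p gives U = (eps - 1) gam phi delta K /
    (1 - delta gam); the price condition and P = kappa + omega then give omega / kappa = (eps - 1)
    [1 + (1 - delta) gam phi / (1 - delta gam)]. The discount factor could bring X and Z into the
    dynamics. But X Z = P Y, because fairness cancels, and the remaining p + y - c^p is multiplied
    by the steady-state condition for C^p, hence drops out. At date t + 1 the multiplier kappa acts
    twice, directly through demand and again through chi. The two effects add up to eps + (eps - 1)
    phi in [lambda2], against eps + (eps - 1) gam phi in [lambda1]. *)

Section ConditionalExpectation.
Set Implicit Arguments.
Unset Strict Implicit.
Context {R : realType} {d : measure_display} {Omega : measurableType d}.
Variable Pr : probability Omega R.
Implicit Types (G : set (set Omega)) (X Y : Omega -> R).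

Definition adapted G X := measurable_wrt G X /\ Pr.-integrable setT (EFin \o X).

(** A sigma-algebra generates itself, so [measurable_wrt] is ordinary measurability on the space
    [g_sigma_algebraType G], where the closure properties of measurable functions are available. *)
Lemma measurable_wrtE G X : sigma_algebra setT G ->
  measurable_wrt G X <-> measurable_fun setT (X : g_sigma_algebraType G -> R).
Proof.
move=> sG; have GE : (measurable : set (set (g_sigma_algebraType G))) = G.
  exact: smallest_id.
split=> [mX _ B mB|mX B mB].
  by rewrite setTI GE; exact: mX.
by have := mX measurableT _ mB; rewrite setTI GE.
Qed.

Lemma adapted_lin G X Y (a b : R) : sigma_algebra setT G ->
  adapted G X -> adapted G Y -> adapted G (fun w => a * X w + b * Y w).
Proof.
move=> sG [mX iX] [mY iY]; split.
  apply/measurable_wrtE => //.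
  move/(measurable_wrtE _ sG) in mX; move/(measurable_wrtE _ sG) in mY.
  by apply: measurable_realfun.measurable_funD;
    apply: measurable_realfun.measurable_funM => //; exact: measurable_cst.
rewrite (_ : _ \o _ = ((fun w => a%:E * (X w)%:E) \+ (fun w => b%:E * (Y w)%:E))%E).
  by apply: integrableD => //; apply: integrableZl.
by apply/funext => w /=.
Qed.

Lemma integrable_lin X Y (a b : R) : Pr.-integrable setT (EFin \o X) ->
  Pr.-integrable setT (EFin \o Y) ->
  Pr.-integrable setT (EFin \o (fun w => a * X w + b * Y w)).
Proof.
move=> iX iY.
rewrite (_ : _ \o _ = ((fun w => a%:E * (X w)%:E) \+ (fun w => b%:E * (Y w)%:E))%E).
  by apply: integrableD => //; apply: integrableZl.
by apply/funext => w /=.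
Qed.

Lemma integral_lin (A : set Omega) X Y (a b : R) : measurable A ->
  Pr.-integrable setT (EFin \o X) -> Pr.-integrable setT (EFin \o Y) ->
  (\int[Pr]_(w in A) (a * X w + b * Y w)%:E =
   a%:E * \int[Pr]_(w in A) (X w)%:E + b%:E * \int[Pr]_(w in A) (Y w)%:E)%E.
Proof.
move=> mA iX iY.
have iA Z : Pr.-integrable setT (EFin \o Z) -> Pr.-integrable A (EFin \o Z).
  by move=> iZ; apply: integrableS iZ => //.
under eq_integral do rewrite EFinD !EFinM.
rewrite integralD//; try by apply: integrableZl => //; exact: iA.
by rewrite !integralZl//; exact: iA.
Qed.

(** The event where [X] exceeds [Y] lies in [G], so [X - Y] integrates to zero over it; as the
    integrand is positive there, the event is null. *)
Lemma adapted_ae_le G X Y : sigma_algebra setT G -> G `<=` measurable ->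
  adapted G X -> adapted G Y ->
  (forall A, G A -> (\int[Pr]_(w in A) (X w)%:E = \int[Pr]_(w in A) (Y w)%:E)%E) ->
  {ae Pr, forall w, X w <= Y w}.
Proof.
move=> sG Gm aX aY XY.
have [mD iD] := adapted_lin 1 (-1) sG aX aY.
set D := (fun w => _) in mD iD.
pose A := D @^-1` `]0, +oo[%classic.
have GA : G A by apply: mD; exact: measurable_itv.
have mA := Gm _ GA.
have iDA : Pr.-integrable A (EFin \o D) by apply: integrableS iD.
have : (\int[Pr]_(w in A) `|(EFin \o D) w| = 0)%E.
  transitivity (\int[Pr]_(w in A) (D w)%:E)%E.
    apply: eq_integral => w; rewrite inE /A /= in_itv /= andbT => D0.
    by rewrite ger0_norm ?ltW.
  have [iX iY] := (aX.2, aY.2).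
  rewrite /D integral_lin// XY// -muleDl//; last first.
    by apply: integrable_fin_num => //; exact: integrableS iY.
  by rewrite -EFinD subrr mul0e.
move=> /(ae_eq_integral_abs Pr mA (measurable_int _ iDA)).
apply: filterS => w /= h; rewrite leNgt; apply/negP => YX.
have Dw : 0 < D w by rewrite /D mul1r mulN1r subr_gt0.
have : A w by rewrite /A /= in_itv /= andbT.
by move=> /h [] Dw0; rewrite Dw0 ltxx in Dw.
Qed.

Lemma adapted_ae_eq G X Y : sigma_algebra setT G -> G `<=` measurable ->
  adapted G X -> adapted G Y ->
  (forall A, G A -> (\int[Pr]_(w in A) (X w)%:E = \int[Pr]_(w in A) (Y w)%:E)%E) ->
  {ae Pr, forall w, X w = Y w}.
Proof.
move=> sG Gm aX aY XY.
have := adapted_ae_le sG Gm aX aY XY.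
have := adapted_ae_le sG Gm aY aX (fun A GA => esym (XY A GA)).
by apply: filterS2 => w YX XY'; apply/eqP; rewrite eq_le YX XY'.
Qed.

Variables (Fil : int -> set (set Omega)) (E : int -> (Omega -> R) -> Omega -> R).
Hypotheses (HF : filtration Fil) (HE : conditional_expectations Pr Fil E).

Let sF t : sigma_algebra setT (Fil t). Proof. by case: HF. Qed.
Let Fm t : Fil t `<=` measurable. Proof. by case: HF. Qed.

Lemma adapted_le (s t : int) X : s <= t -> adapted (Fil s) X -> adapted (Fil t) X.
Proof.
move=> st [mX iX]; split => // B mB.
by case: HF => _ _ /(_ _ _ st); apply; exact: mX.
Qed.

Lemma cond_exp_adapted t X : Pr.-integrable setT (EFin \o X) ->
  adapted (Fil t) (E t X).
Proof. by move=> iX; have [? ? _] := HE t iX. Qed.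

Lemma cond_exp_id t X : adapted (Fil t) X -> {ae Pr, forall w, E t X w = X w}.
Proof.
move=> aX; have [mE iE EX] := HE t aX.2.
by apply: (@adapted_ae_eq (Fil t)).
Qed.

(** Almost surely equal variables may be sent to different versions, but these have the same
    integral over every event of [Fil t], and [adapted_ae_eq] identifies them. *)
Lemma cond_exp_ae t X Y : Pr.-integrable setT (EFin \o X) ->
  Pr.-integrable setT (EFin \o Y) -> {ae Pr, forall w, X w = Y w} ->
  {ae Pr, forall w, E t X w = E t Y w}.
Proof.
move=> iX iY XY; have [mE iE EX] := HE t iX; have [mE' iE' EY] := HE t iY.
apply: (@adapted_ae_eq (Fil t)) => // A FA; rewrite EX// EY//.
have mA := Fm FA.
apply: ae_eq_integral => //.
- by apply: (measurable_funS measurableT) (measurable_int _ iX).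
- by apply: (measurable_funS measurableT) (measurable_int _ iY).
- by apply: filterS XY => w XYw _ /=; rewrite XYw.
Qed.

Lemma cond_exp_lin t X Y (a b : R) : Pr.-integrable setT (EFin \o X) ->
  Pr.-integrable setT (EFin \o Y) ->
  {ae Pr, forall w, E t (fun w => a * X w + b * Y w) w = a * E t X w + b * E t Y w}.
Proof.
move=> iX iY; have iXY := integrable_lin a b iX iY.
have [mE iE EX] := HE t iX; have [mE' iE' EY] := HE t iY.
apply: (@adapted_ae_eq (Fil t)) => //; first exact: cond_exp_adapted.
  by apply: adapted_lin => //; exact: cond_exp_adapted.
move=> A FA; have mA := Fm FA; have [_ _ ->//] := HE t iXY.
by rewrite integral_lin// integral_lin// EX// EY.
Qed.

End ConditionalExpectation.

(** * Derivatives and the fairness function *)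

Section Fairness.
Set Implicit Arguments.
Unset Strict Implicit.
Context {R : realType}.

Lemma is_derive_chain (f g : R -> R) (x y a b : R) :
  is_derive y 1 f a -> is_derive x 1 g b -> g x = y -> is_derive x 1 (fun z => f (g z)) (a * b).
Proof. move=> df dg gx; rewrite -gx in df *. exact (@is_derive1_comp _ f g x a b df dg). Qed.

Lemma is_derive_mul (f g : R -> R) (x a b : R) : is_derive x 1 f a ->
  is_derive x 1 g b -> is_derive x 1 (fun z => f z * g z) (a * g x + f x * b).
Proof.
move=> df dg; have -> : a * g x + f x * b = f x *: b + g x *: a.
  by rewrite /GRing.scale /= addrC (mulrC a).
exact (is_deriveM df dg).
Qed.

Lemma is_derive_add (f g : R -> R) (x a b : R) : is_derive x 1 f a ->
  is_derive x 1 g b -> is_derive x 1 (fun z => f z + g z) (a + b).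
Proof. move=> df dg; exact (is_deriveD df dg). Qed.

Lemma is_derive_opp (f : R -> R) (x a : R) : is_derive x 1 f a ->
  is_derive x 1 (fun z => - f z) (- a).
Proof. move=> df; exact (is_deriveN df). Qed.

Lemma is_derive_inv (f : R -> R) (x a : R) : f x != 0 -> is_derive x 1 f a ->
  is_derive x 1 (fun z => (f z)^-1) (- a / f x ^+ 2).
Proof.
move=> fx df; have -> : - a / f x ^+ 2 = - (f x) ^- 2 *: a.
  by rewrite /GRing.scale /= !mulNr mulrC.
exact (is_deriveV fx df).
Qed.

Lemma is_derive_cast (f : R -> R) (x a b : R) :
  is_derive x 1 f a -> a = b -> is_derive x 1 f b.
Proof. by move=> df <-. Qed.

Lemma is_derive_affine (a b x : R) : is_derive x 1 (fun z => a * z + b) a.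
Proof.
have := is_derive_add (is_derive_mul (is_derive_cst a x 1) (is_derive_id x 1))
  (is_derive_cst b x 1).
by rewrite /= mul0r add0r addr0 mulr1.
Qed.

Lemma derive1_val (f : R -> R) (x l : R) : is_derive x 1 f l -> derive1 f x = l.
Proof. by move=> df; rewrite derive1E derive_val. Qed.

(** Around an interior point all small increments stay in the segment, so the restricted limit is
    the two-sided one. *)
Lemma derivative_on_segment_interior (a b : R) (f f' : R -> R) (m : R) :
  derivative_on_segment a b f f' -> a < m < b -> is_derive m 1 f (f' m).
Proof.
move=> ff' /andP[am mb].
have fm : h^-1 *: ((f \o shift m) (h *: 1) - f m) @[h --> 0^'] --> f' m.
  have amb : a <= m <= b by rewrite !ltW.
  apply: cvg_trans (ff' m amb) => /= A [e /= e0 he].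
  rewrite !near_simpl.
  near=> h.
  have h0 : h != 0 by near: h; exact: nbhs_dnbhs_neq.
  have -> : h^-1 *: (f (h *: 1 + m) - f m)
      = (f (h + m) - f m) / ((h + m) - m).
    by rewrite addrK /GRing.scale /= mulr1 mulrC.
  have hlt : `|h| < Num.min e (Num.min (m - a) (b - m)).
    by near: h; apply: dnbhs0_lt; rewrite !lt_min e0 !subr_gt0 am mb.
  move: hlt; rewrite !lt_min => /and3P[he' ha hb].
  apply: he.
    by rewrite /= (_ : m - (h + m) = - h) ?normrN //; ring.
  move: ha hb; rewrite !ltr_norml => /andP[? ?] /andP[? ?].
  split; first by apply/andP; split; lra.
  by rewrite -subr_eq0 addrK.
apply: DeriveDef; last exact: cvg_lim fm.
by apply/cvg_ex; exists (f' m).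
Unshelve. all: by end_near. Qed.

(** The two-sided limit is also the limit from the right, where the difference quotients are
    nonnegative. The range [[0, 1]] is that of the weight in a convex combination. *)
Lemma is_derive_ge0_right (g : R -> R) (l : R) : is_derive (0 : R) 1 g l -> g 0 = 0 ->
  (forall s, 0 <= s <= 1 -> 0 <= g s) -> 0 <= l.
Proof.
move=> [dg <-] g0 gge0; rewrite leNgt; apply/negP => l0.
have gl : h^-1 *: ((g \o shift 0) (h *: 1) - g 0) @[h --> 0^'+] --> 'D_1 g (0 : R).
  have : h^-1 *: ((g \o shift 0) (h *: 1) - g 0) @[h --> 0^'] --> 'D_1 g (0 : R) by [].
  apply: cvg_trans; apply: cvg_app => A /= [r r0 rA].
  by exists r => // h hr h0; apply: rA => //; rewrite gt_eqF.
suff : 0 <= 'D_1 g (0 : R) by rewrite leNgt l0.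
apply: (cvgr_to_ge gl).
near=> h.
have h0 : 0 < h by [].
have h1 : h <= 1 by near: h; exact: nbhs_right_le.
rewrite /= g0 subr0 addr0 [h *: 1]mulr1.
by apply: mulr_ge0; [rewrite invr_ge0 ltW|apply: gge0; rewrite ltW].
Unshelve. all: by end_near. Qed.

(** Along the segment from [a] to [b], [g] is the gap between [Fair e] and its chord: it starts at
    zero and is nonnegative by concavity, so its slope at 0 is nonnegative, and that slope is the
    tangent inequality. *)
Lemma concave_tangent (e : economy R) (f1 : R -> R) (a b : R) :
  0 <= a <= Mh e -> 0 <= b <= Mh e -> is_derive a 1 (Fair e) (f1 a) ->
  Fair e b <= Fair e a + f1 a * (b - a).
Proof.
move=> a0 b0 da.
pose g s := Fair e (s * b + (1 - s) * a) - (s * Fair e b + (1 - s) * Fair e a).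
suff : 0 <= f1 a * (b - a) - (Fair e b - Fair e a) by lra.
have dl (x y : R) : is_derive (0 : R) 1 (fun s => s * y + (1 - s) * x) (y - x).
  rewrite (_ : (fun s : R => _) = (fun s => (y - x) * s + x)).
    exact: is_derive_affine.
  by apply/funext => s; ring.
have a0l : 0 * b + (1 - 0) * a = a by rewrite mul0r add0r subr0 mul1r.
have dg : is_derive (0 : R) 1 g (f1 a * (b - a) - (Fair e b - Fair e a)) :=
  is_derive_add (is_derive_chain da (dl a b) a0l)
    (is_derive_opp (dl (Fair e a) (Fair e b))).
apply: (is_derive_ge0_right dg).
- by rewrite /g; rewrite !mul0r !add0r !subr0 !mul1r subrr.
- by move=> s s01; rewrite /g subr_ge0; exact: Fair_concave.
Qed.

Lemma Fair_derivatives (e : economy R) : exists f1 f2 : R -> R,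
  forall m : R, 0 < m < Mh e ->
  [/\ is_derive m 1 (Fair e) (f1 m), is_derive m 1 f1 (f2 m), f1 m < 0 & f2 m <= 0].
Proof.
have [f1 [f2 [F1 F2]]] := Fair_diff2 e.
have dF (m : R) : 0 < m < Mh e -> is_derive m 1 (Fair e) (f1 m).
  exact: derivative_on_segment_interior.
have dF' (m : R) : 0 < m < Mh e -> is_derive m 1 f1 (f2 m).
  exact: derivative_on_segment_interior.
(* Adding the tangent inequalities at [a] and at [b] gives [0 <= (f1 a - f1 b) * (b - a)]. *)
have decr (a b : R) : 0 < a < Mh e -> 0 < b < Mh e -> a < b -> f1 b <= f1 a.
  move=> a0 b0 ab.
  have a0' : 0 <= a <= Mh e by case/andP : a0 => *; rewrite !ltW.
  have b0' : 0 <= b <= Mh e by case/andP : b0 => *; rewrite !ltW.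
  have := concave_tangent a0' b0' (dF _ a0).
  have := concave_tangent b0' a0' (dF _ b0).
  move: (Fair e a) (Fair e b) => A B h1 h2.
  have : 0 <= (f1 a - f1 b) * (b - a) by lra.
  by rewrite pmulr_lge0 ?subr_gt0// subr_ge0.
exists f1, f2 => m m0; have d2 := dF' _ m0; split; [exact: dF|exact: d2| |].
(* Strict decrease alone would only give [f1 m <= 0]. Strictness comes from the tangent at [m]
   evaluated at 0, where [Fair e] is strictly larger than at [m]. *)
- have m0' : 0 <= m <= Mh e by case/andP : m0 => *; rewrite !ltW.
  have z0 : 0 <= (0 : R) <= Mh e.
    by rewrite lexx /=; case/andP: m0'; exact: le_trans.
  have := concave_tangent m0' z0 (dF _ m0).
  case/andP : (m0) => m1 m2.
  have := Fair_decr (lexx _) m1 (ltW m2).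
  move: (Fair e m) (Fair e 0) => A B h1 h2.
  have : 0 < (- f1 m) * m by lra.
  by rewrite pmulr_lgt0// oppr_gt0.
- rewrite -oppr_ge0; case/andP: (m0) => m1 m2.
  (* Half the distance to [Mh e], so that [m + s * D] stays strictly below [Mh e] for every [s] up
     to 1. *)
  pose D := (Mh e - m) / 2; have D0 : 0 < D by rewrite divr_gt0// subr_gt0.
  rewrite -(pmulr_lge0 _ D0).
  have dl : is_derive (0 : R) 1 (fun s : R => m + s * D) D.
    rewrite (_ : (fun s : R => _) = (fun s => D * s + m)).
      exact: is_derive_affine.
    by apply/funext => s; ring.
  have m0l : m + 0 * D = m by rewrite mul0r addr0.
  have dg : is_derive (0 : R) 1 (fun s => f1 m - f1 (m + s * D)) (- f2 m * D).
    apply: (is_derive_cast (is_derive_add (is_derive_cst (f1 m) (0 : R) 1)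
      (is_derive_opp (is_derive_chain d2 dl m0l)))).
    by rewrite add0r mulNr.
  apply: (is_derive_ge0_right dg).
  + by rewrite mul0r addr0 subrr.
  + move=> s /andP[s0 s1]; rewrite subr_ge0.
    have [->|sN0] := eqVneq s 0; first by rewrite mul0r addr0.
    have sD : 0 < s * D by rewrite mulr_gt0// lt_neqAle eq_sym sN0.
    have sD' : s * D <= D by rewrite ler_piMl// ltW.
    have D2 : D * 2 = Mh e - m by rewrite /D mulfVK.
    by apply: decr => //; [apply/andP; split; lra | lra].
Qed.

Lemma elasticity_val (f : R -> R) (m l : R) : 0 < m -> 0 < f m ->
  is_derive m 1 f l -> elasticity f m = l * m / f m.
Proof.
move=> m0 f0 df; have em : expR (ln m) = m by rewrite lnK// posrE.
rewrite /elasticity; apply: derive1_val.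
apply: (is_derive_cast (is_derive_chain (is_derive1_ln f0)
  (is_derive_chain df (is_derive_expR _) em) (congr1 f em))).
by rewrite em mulrC.
Qed.

(** With phi = - m F' / F, the derivative of phi is - m F'' / F - F' / F + m F'^2 / F^2: no term is
    negative, and the last two are positive. The derivatives are stated as elasticity times value
    over argument, the form that [log_derive_comp] consumes. *)
Lemma phi_facts (e : economy R) (m : R) : 0 < m < Mh e ->
  [/\ 0 < phi e m, 0 < sigma e m,
     is_derive m 1 (Fair e) (- phi e m * (Fair e m / m)) &
     is_derive m 1 (phi e) (sigma e m * (phi e m / m))].
Proof.
have [f1 [f2 H]] := Fair_derivatives e.
have F_gt0 y : 0 < y < Mh e -> 0 < Fair e y.
  by move=> /andP[y0 y1]; rewrite Fair_gt0// ltW.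
have phiE y : 0 < y < Mh e -> phi e y = - f1 y * y / Fair e y.
  move=> y0; have [dy _ _ _] := H _ y0; case/andP: (y0) => y1 _.
  by rewrite /phi (elasticity_val y1 (F_gt0 _ y0) dy) !mulNr.
move=> m0; have [d1 d2 f10 f20] := H _ m0.
case/andP: (m0) => m1 m2; have F0 := F_gt0 _ m0.
have F0n := lt0r_neq0 F0.
have p0 : 0 < phi e m by rewrite phiE// divr_gt0// mulr_gt0// oppr_gt0.
have dphi : is_derive m 1 (phi e)
   (- ((f2 m * m + f1 m) / Fair e m - f1 m * m * f1 m / Fair e m ^+ 2)).
  have dq : is_derive m 1 (fun y => - f1 y * y / Fair e y)
   (- ((f2 m * m + f1 m) / Fair e m - f1 m * m * f1 m / Fair e m ^+ 2)).
    refine (is_derive_cast (is_derive_mul (is_derive_mul (is_derive_opp d2)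
      (is_derive_id m 1)) (is_derive_inv F0n d1)) _).
    by rewrite /=; field.
  (* The closed form of [phi] is known only on the open interval, so the derivative is transferred
     along an equality near [m]. *)
  apply: near_eq_is_derive dq; near=> y.
  rewrite phiE//.
  by apply/andP; split; near: y; [exact: lt_nbhsr|exact: lt_nbhsl].
have sE := elasticity_val m1 p0 dphi; rewrite -/(sigma e m) in sE.
split => //.
- rewrite sE divr_gt0// mulr_gt0// opprB subr_gt0.
  apply: (@lt_trans _ _ 0).
    rewrite pmulr_llt0 ?invr_gt0//.
    have : f2 m * m <= 0 by rewrite mulr_le0_ge0// ltW.
    by move: f10; move: (f1 m) (f2 m * m) => a b; lra.
  by rewrite divr_gt0 ?exprn_gt0// nmulr_lgt0// nmulr_rlt0.
- apply: (is_derive_cast d1); rewrite phiE//; field.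
  by rewrite F0n gt_eqF.
- apply: (is_derive_cast dphi); rewrite sE; move: (phi e m) p0 => p p0; field.
  by rewrite !gt_eqF.
Unshelve. all: by end_near. Qed.

End Fairness.

(** * A calculus of logarithmic derivatives *)

Section LogDerivative.
Set Implicit Arguments.
Unset Strict Implicit.
Context {R : realType}.
Implicit Types (f g : R -> R) (a b k l p : R).

(** Here [k] is the derivative of [ln f] at [p]. Value, sign and slope travel together, so that
    products, inverses and powers act linearly on [k] without positivity side conditions; this is
    log-linearization made compositional. *)
Definition log_derive p f a k :=
  [/\ f p = a, 0 < a & is_derive p 1 f (a * k)].

Lemma log_derive_derive p f a k : log_derive p f a k -> is_derive p 1 f (a * k).
Proof. by case. Qed.

Lemma log_derive_cast p f a b k l :
  log_derive p f a k -> a = b -> k = l -> log_derive p f b l.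
Proof. by move=> df <- <-. Qed.

Lemma log_derive_mul p f g a b k l : log_derive p f a k -> log_derive p g b l ->
  log_derive p (fun s => f s * g s) (a * b) (k + l).
Proof.
move=> [fa a0 df] [gb b0 dg]; split; [by rewrite fa gb|exact: mulr_gt0|].
by apply: (is_derive_cast (is_derive_mul df dg)); rewrite fa gb; ring.
Qed.

Lemma log_derive_inv p f a k : log_derive p f a k ->
  log_derive p (fun s => (f s)^-1) a^-1 (- k).
Proof.
move=> [fa a0 df]; split; [by rewrite fa|by rewrite invr_gt0|].
have fx : f p != 0 by rewrite fa gt_eqF.
by apply: (is_derive_cast (is_derive_inv fx df)); rewrite fa; field; rewrite gt_eqF.
Qed.

(** [l] is the elasticity of [g] at [a]: log-deviations are multiplied by elasticities under
    composition. *)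
Lemma log_derive_comp p f g a b k l : log_derive p f a k -> 0 < b -> g a = b ->
  is_derive a 1 g (l * (b / a)) -> log_derive p (fun s => g (f s)) b (l * k).
Proof.
move=> [fa a0 df] b0 gab dg; split; [by rewrite fa|by []|].
by apply: (is_derive_cast (is_derive_chain dg df fa)); field; rewrite gt_eqF.
Qed.

Lemma log_derive_powR p f a k (c : R) : log_derive p f a k ->
  log_derive p (fun s => f s `^ c) (a `^ c) (c * k).
Proof.
move=> df; case: (df) => _ a0 _.
have ac0 : 0 < a `^ c by apply: powR_gt0.
refine (log_derive_comp df ac0 (erefl : (fun y => y `^ c) a = _) _).
apply: (is_derive_cast (is_derive1_powR c a0)).
by rewrite powRB ?(gt_eqF a0) ?implybT// powRr1// ltW.
Qed.

Lemma log_derive_cst p a : 0 < a -> log_derive p (fun=> a) a 0.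
Proof.
by move=> a0; split=> //; apply: (is_derive_cast (is_derive_cst a p 1)); rewrite mulr0.
Qed.

Lemma log_derive_id p : 0 < p -> log_derive p (fun s => s) p p^-1.
Proof.
move=> a0; split=> //; apply: (is_derive_cast (is_derive_id p 1)).
by rewrite mulfV ?gt_eqF.
Qed.

Lemma log_derive_exp a h : 0 < a -> log_derive 0 (fun s => a * expR (s * h)) a h.
Proof.
move=> a0; split; rewrite ?mul0r ?expR0 ?mulr1//.
have dl : is_derive (0 : R) 1 (fun s => s * h) h.
  apply: (is_derive_cast (is_derive_mul (is_derive_id _ _) (is_derive_cst h _ _))).
  by rewrite /= mulr0 addr0 mul1r.
have h0 : 0 * h = 0 by rewrite mul0r.
apply: (is_derive_cast (is_derive_mul (is_derive_cst a _ _)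
  (is_derive_chain (is_derive_expR 0) dl h0))).
by rewrite /= expR0 mul1r mul0r add0r.
Qed.

Lemma log_derive_near p f a k b c : log_derive p f a k -> b < a < c ->
  \near p, b < f p < c.
Proof.
move=> [fa a0 [df _]] /andP[ba ac].
have cf : f x @[x --> p] --> a.
  by rewrite -fa; apply: differentiable_continuous; exact/derivable1_diffP.
near=> x; apply/andP; split; near: x.
  exact: (cvgr_gt _ cf).
exact: (cvgr_lt _ cf).
Unshelve. all: by end_near. Qed.

Lemma derive1_near (f g : R -> R) (x l : R) : is_derive x 1 g l ->
  (\near x, g x = f x) -> derive1 f x = l.
Proof. by move=> dg gf; apply: derive1_val; apply: near_eq_is_derive dg. Qed.

(** Only a few terms of a Lagrangian contain the chosen variable. Taking the constant to be
    [f x - g x] lets [ring] discard the others without naming them. *)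
Lemma derive1_upto_cst (f g : R -> R) (x l : R) : is_derive x 1 g l ->
  (\forall y \near x, f y = g y + (f x - g x)) -> derive1 f x = l.
Proof.
move=> dg; set c := f x - g x => fg.
have dgc : is_derive x 1 (fun y => g y + c) l.
  by apply: (is_derive_cast (is_derive_add dg (is_derive_cst c x 1))); rewrite addr0.
by apply: (derive1_near dgc); apply: filterS fg => y ->.
Qed.

End LogDerivative.

(** * First-order conditions of the agents *)

(* Conversion tests between atoms such as [x t v] and [x (t + 1) v] would make
   [ring] diverge. *)
Ltac generalize_atoms :=
  repeat match goal with
  | |- context [ln ?u] => generalize (ln u); intro
  | |- context [goods_demand ?e ?x ?t ?p ?c] =>
      generalize (goods_demand e x t p c); intro
  | |- context [law_of_motion ?e ?c ?p] => generalize (law_of_motion e c p); intro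
  | |- context [sdf ?e ?x ?t ?n] => generalize (sdf e x t n); intro
  | |- context [int01 ?f] => generalize (int01 f); intro
  | |- context [ces ?r ?f] => generalize (ces r f); intro
  | |- context [?a `^ ?b] => generalize (a `^ b); intro
  | |- context [?a^-1] => generalize (a^-1); intro
  | |- context [?x ?t ?v] => is_var x;
      match type of x with trajectory _ => generalize (x t v); intro end
  end.

Section Conditions.
Set Implicit Arguments.
Unset Strict Implicit.
Context {R : realType} (e : economy R).

Lemma int01_cst (f : R -> R) (a : R) : (forall j, 0 <= j <= 1 -> f j = a) ->
  int01 f = a.
Proof.
move=> fa; rewrite /int01 (@eq_Rintegral _ _ _ _ _ (fun=> a)); last first.
  by move=> j; rewrite inE /= in_itv /=; exact: fa.
rewrite Rintegral_cst//= lebesgue_measure_itv /= lte_fin ltr01.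
by rewrite oppr0 adde0 mulr1.
Qed.

Lemma ces_cst (r : R) (f : R -> R) (a : R) : r != 0 -> 0 < a ->
  (forall j, 0 <= j <= 1 -> f j = a) -> ces r f = a.
Proof.
move=> r0 a0 fa; rewrite /ces (int01_cst (a := a `^ r)); last by move=> j /fa ->.
by rewrite -powRrM mulfV// powRr1// ltW.
Qed.

Lemma shift_on_unit (a z j : R) : 0 <= j <= 1 -> shift_on `[0, 1] a z j = a + z.
Proof. by move=> j01; rewrite /shift_on indicE mem_set ?mulr1//= in_itv. Qed.

Definition positive (x : trajectory R) := forall t v, ~~ in_levels v -> 0 < x t v.

Lemma ces_eps_neq0 : (eps e - 1) / eps e != 0.
Proof.
have g1 := eps_gt1 e; have g0 := lt_trans ltr01 g1.
by rewrite mulf_neq0 ?invr_eq0 ?gt_eqF// subr_gt0.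
Qed.

Lemma ces_nu_neq0 : (nu e - 1) / nu e != 0.
Proof.
have g1 := nu_gt1 e; have g0 := lt_trans ltr01 g1.
by rewrite mulf_neq0 ?invr_eq0 ?gt_eqF// subr_gt0.
Qed.

Lemma next_neq (t : int) : (t + 1 == t) = false.
Proof. by rewrite -subr_eq0 addrAC subrr add0r. Qed.

Lemma prev_neq (t : int) : (t - 1 == t) = false.
Proof. by rewrite -subr_eq0 addrAC subrr add0r. Qed.

(** Decides the date tests that [set_at] leaves at [t - 1], [t] and [t + 1]. *)
Definition dateE := (addr0, addrK, next_neq, prev_neq, eqxx).

Lemma household_lagrangianE (x y : trajectory R) (t : int) c :
  household_lagrangian e x t y c =
  household_term e x y c t + delta e * household_term e x y c (t + 1).
Proof.
by rewrite /household_lagrangian !big_ord_recl big_ord0 /= addr0 expr0 mul1r expr1 addr0.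
Qed.

Lemma sdf1 (x : trajectory R) (t : int) :
  sdf e x t 1 = delta e * ((x t PriceIndex * x t Consumption)
                  / (x (t + 1) PriceIndex * x (t + 1) Consumption)).
Proof. by rewrite /sdf expr1. Qed.

Lemma firm_lagrangianE (x y : trajectory R) (t : int) c : positive x ->
  firm_lagrangian e x t y c =
  firm_term e x y c t + sdf e x t 1 * firm_term e x y c (t + 1).
Proof.
move=> px; have X0 : x t PriceIndex * x t Consumption != 0.
  by rewrite mulf_neq0// gt_eqF// px.
rewrite /firm_lagrangian !big_ord_recl big_ord0 /= !addr0.
by rewrite {1}/sdf expr0 !addr0 divff// !mul1r.
Qed.

Lemma household_foc_labor (x : trajectory R) (t : int) : positive x ->
  household_foc e Labor t x =
  x t MultBudget * x t Wage - x t Labor `^ Defs.eta e - x t MultLaborDem.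
Proof.
move=> px; rewrite /household_foc.
have N0 : 0 < x t Labor by exact: px.
pose g z := - (z `^ (1 + Defs.eta e) * (1 + Defs.eta e)^-1) +
  ((x t MultBudget * x t Wage - x t MultLaborDem) * z + 0).
have dg : is_derive (x t Labor) 1 g
    (- (x t Labor `^ Defs.eta e) + (x t MultBudget * x t Wage - x t MultLaborDem)).
  apply: (is_derive_cast (is_derive_add (is_derive_opp (is_derive_mul
    (is_derive1_powR (1 + Defs.eta e) N0) (is_derive_cst (1 + Defs.eta e)^-1 _ _)))
    (is_derive_affine _ _ _))).
  rewrite /= mulr0 addr0 (addrC 1) addrK; field.
  by have := eta_gt0 e; move: (Defs.eta e) => h h0; rewrite gt_eqF//; lra.
rewrite (derive1_upto_cst (g := g) dg); first by ring.
near=> z.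
rewrite !household_lagrangianE /household_term /set_at /labor_demand /= !dateE /= /g.
by generalize_atoms; ring.
Unshelve. all: by end_near. Qed.

(** The wage index in [labor_demand] stays fixed while the own wage moves; at the symmetric point
    their ratio is 1, so the power contributes only its exponent [- nu e]. *)
Lemma household_foc_wage (x : trajectory R) (t : int) : positive x ->
  household_foc e Wage t x =
  x t MultBudget * x t Labor
  - x t MultLaborDem * (nu e * x t Labor / x t Wage).
Proof.
move=> px; rewrite /household_foc.
have W0 : 0 < x t Wage by exact: px.
have W0n := lt0r_neq0 W0.
pose g z := (x t MultBudget * x t Labor * z + 0) +
  (x t MultLaborDem * x t Labor) * (z / x t Wage) `^ (- nu e).
have dr := log_derive_mul (log_derive_id W0)
  (log_derive_cst (x t Wage) (a := (x t Wage)^-1) ltac:(by rewrite invr_gt0)).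
have dg := is_derive_add (is_derive_affine (x t MultBudget * x t Labor) 0 (x t Wage))
  (is_derive_mul (is_derive_cst (x t MultLaborDem * x t Labor) (x t Wage) 1)
     (log_derive_derive (log_derive_powR (- nu e) dr))).
rewrite (derive1_upto_cst (g := g) dg).
  by rewrite /= divff// powR1 addr0; field.
near=> z.
rewrite !household_lagrangianE /household_term /set_at /labor_demand /= !dateE /= /g.
by generalize_atoms; ring.
Unshelve. all: by end_near. Qed.

(* On the whole unit interval the shifted profile is constant, so no derivative
   under the integral is needed. *)
Lemma purchase_foc_all (x : trajectory R) (t : int) : positive x ->
  purchase_foc e `[0, 1] t x =
  (x t Output)^-1 - x t MultBudget * x t Price.
Proof.
move=> px; rewrite /purchase_foc.
have Y0 : 0 < x t Output by exact: px.
have F0 : 0 < x t Fairness by exact: px.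
pose g z := ln (x t Fairness * (1 * z + x t Output)) +
  - (x t MultBudget * x t Price * z + 0).
have Y0' : 1 * 0 + x t Output = x t Output by rewrite mulr0 add0r.
have FY0 : 0 < x t Fairness * x t Output by rewrite mulr_gt0.
have dl := is_derive_mul (is_derive_cst (x t Fairness) (0 : R) 1)
  (is_derive_affine 1 (x t Output) 0).
have dg := is_derive_add
  (is_derive_chain (is_derive1_ln FY0) dl (congr1 ( *%R (x t Fairness)) Y0'))
  (is_derive_opp (is_derive_affine (x t MultBudget * x t Price) 0 0)).
rewrite (derive1_upto_cst (g := g) dg).
  by rewrite mul0r add0r /=; field; rewrite !gt_eqF.
near=> z.
have Yz : 0 < x t Output + z.
  by rewrite addrC -ltrBlDr sub0r; near: z; apply: lt_nbhsr; rewrite oppr_lt0.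
have intE (u : R) : int01 (fun j => x t Price * shift_on `[0, 1] (x t Output) u j)
    = x t Price * (x t Output + u).
  by apply: int01_cst => j j01; rewrite shift_on_unit.
have cesE (u : R) : 0 < x t Output + u ->
    ces ((eps e - 1) / eps e) (fun j => x t Fairness * shift_on `[0, 1] (x t Output) u j)
    = x t Fairness * (x t Output + u).
  move=> u0; apply: ces_cst; [exact: ces_eps_neq0|exact: mulr_gt0|].
  by move=> j j01; rewrite shift_on_unit.
rewrite !household_lagrangianE /household_term /labor_demand !dateE /= /g !intE !cesE ?addr0//.
rewrite (_ : 1 * z + x t Output = x t Output + z) ?Y0'; last by rewrite mul1r addrC.
by generalize_atoms; ring.
Unshelve. all: by end_near. Qed.

Lemma firm_foc_output (x : trajectory R) (t : int) : positive x ->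
  firm_foc e Output t x = x t Price - x t MultDemand - x t MultProd.
Proof.
move=> px; rewrite /firm_foc.
apply: (derive1_upto_cst (is_derive_affine (x t Price - x t MultDemand - x t MultProd) 0 _)).
near=> z; rewrite !firm_lagrangianE// /firm_term /set_at /= !dateE /=.
by generalize_atoms; ring.
Unshelve. all: by end_near. Qed.

Lemma firm_foc_demand (x : trajectory R) (t : int) : positive x ->
  firm_foc e MultDemand t x =
  goods_demand e x t (x t Price) (x (t - 1) PercCost) - x t Output.
Proof.
move=> px; rewrite /firm_foc.
apply: (derive1_upto_cst (is_derive_affine _ 0 _)).
near=> z; rewrite !firm_lagrangianE// /firm_term /set_at /= !dateE /=.
by generalize_atoms; ring.
Unshelve. all: by end_near. Qed.

Lemma firm_foc_prod (x : trajectory R) (t : int) : positive x ->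
  firm_foc e MultProd t x =
  x t Technology * x t Labor `^ alpha e - x t Output.
Proof.
move=> px; rewrite /firm_foc.
apply: (derive1_upto_cst (is_derive_affine _ 0 _)).
near=> z; rewrite !firm_lagrangianE// /firm_term /set_at /= !dateE /=.
rewrite (ces_cst (a := x t Labor)) ?ces_nu_neq0 ?px//.
by generalize_atoms; ring.
Unshelve. all: by end_near. Qed.

Lemma firm_foc_perc (x : trajectory R) (t : int) : positive x ->
  firm_foc e MultPerc t x =
  law_of_motion e (x (t - 1) PercCost) (x t Price) - x t PercCost.
Proof.
move=> px; rewrite /firm_foc.
apply: (derive1_upto_cst (is_derive_affine _ 0 _)).
near=> z; rewrite !firm_lagrangianE// /firm_term /set_at /= !dateE /=.
by generalize_atoms; ring.
Unshelve. all: by end_near. Qed.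

Lemma hiring_foc_all (x : trajectory R) (t : int) : positive x ->
  hiring_foc e `[0, 1] t x =
  x t MultProd * (x t Technology * alpha e * x t Labor `^ (alpha e - 1)) - x t Wage.
Proof.
move=> px; rewrite /hiring_foc.
have N0 : 0 < x t Labor by exact: px.
have Y0' : 1 * 0 + x t Labor = x t Labor by rewrite mulr0 add0r.
pose g z := x t MultProd * x t Technology * (1 * z + x t Labor) `^ alpha e +
  - (x t Wage * z + 0).
have dg := is_derive_add
  (is_derive_mul (is_derive_cst (x t MultProd * x t Technology) (0 : R) 1)
    (is_derive_chain (is_derive1_powR (alpha e) N0)
       (is_derive_affine 1 (x t Labor) 0) Y0'))
  (is_derive_opp (is_derive_affine (x t Wage) 0 0)).
rewrite (derive1_upto_cst (g := g) dg).
  by rewrite /=; ring.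
near=> z.
have Nz : 0 < x t Labor + z.
  by rewrite addrC -ltrBlDr sub0r; near: z; apply: lt_nbhsr; rewrite oppr_lt0.
have intE (u : R) : int01 (fun j => x t Wage * shift_on `[0, 1] (x t Labor) u j)
    = x t Wage * (x t Labor + u).
  by apply: int01_cst => j j01; rewrite shift_on_unit.
have cesE (u : R) : 0 < x t Labor + u ->
    ces ((nu e - 1) / nu e) (shift_on `[0, 1] (x t Labor) u) = x t Labor + u.
  move=> u0; apply: ces_cst; [exact: ces_nu_neq0|by []|].
  by move=> j j01; rewrite shift_on_unit.
rewrite !firm_lagrangianE// /firm_term !dateE /= /g !intE !cesE ?addr0//.
rewrite (_ : 1 * z + x t Labor = x t Labor + z) ?Y0'; last by rewrite mul1r addrC.
by generalize_atoms; ring.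
Unshelve. all: by end_near. Qed.

(** The perceived markup P / C^p with the current perceived cost eliminated through the law of
    motion, as it occurs inside [goods_demand]. *)
Definition demand_markup (p c : R) : R :=
  (eps e / (eps e - 1)) `^ (1 - gam e) * (p / c) `^ gam e.

(** All four arguments are functions, so that one lemma serves the first-order conditions, where
    only the price or only the lagged perceived cost moves, and the expansions, where everything
    moves. The own-price elasticity is minus [eps e + (eps e - 1) * gam e * phi e m], with [m] the
    demand markup. *)
Lemma log_derive_demand p (Z X P C : R -> R) (z0 x0 p0 c0 kz kx kp kc : R) :
  log_derive p Z z0 kz -> log_derive p X x0 kx -> log_derive p P p0 kp ->
  log_derive p C c0 kc -> demand_markup p0 c0 < Mh e ->
  log_derive p (fun s => Z s * (P s / X s) `^ (- eps e) *
     Fair e (demand_markup (P s) (C s)) `^ (eps e - 1))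
   (z0 * (p0 / x0) `^ (- eps e) * Fair e (demand_markup p0 c0) `^ (eps e - 1))
   (kz - eps e * (kp - kx)
    - (eps e - 1) * phi e (demand_markup p0 c0) * (gam e * (kp - kc))).
Proof.
move=> dZ dX dP dC mM.
have e1 := eps_gt1 e; have e0 := lt_trans ltr01 e1.
have cst0 : 0 < (eps e / (eps e - 1)) `^ (1 - gam e).
  by rewrite powR_gt0// divr_gt0// subr_gt0.
have dm := log_derive_mul (log_derive_cst p cst0)
  (log_derive_powR (gam e) (log_derive_mul dP (log_derive_inv dC))).
have m0 : 0 < demand_markup p0 c0 by case: dm.
have m01 : 0 < demand_markup p0 c0 < Mh e by rewrite m0 mM.
have [f0 s0 dF _] := phi_facts m01.
have F0 : 0 < Fair e (demand_markup p0 c0) by rewrite Fair_gt0// ltW.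
have dFm := log_derive_powR (eps e - 1) (log_derive_comp dm F0 erefl dF).
have dq := log_derive_powR (- eps e) (log_derive_mul dP (log_derive_inv dX)).
by apply: (log_derive_cast (log_derive_mul (log_derive_mul dZ dq) dFm)) => //; ring.
Qed.

Lemma log_derive_law p (P C : R -> R) (p0 c0 kp kc : R) :
  log_derive p P p0 kp -> log_derive p C c0 kc ->
  log_derive p (fun s => law_of_motion e (C s) (P s)) (law_of_motion e c0 p0)
    (gam e * kc + (1 - gam e) * kp).
Proof.
move=> dP dC.
have e1 := eps_gt1 e; have e0 := lt_trans ltr01 e1.
have k0 : 0 < (eps e - 1) / eps e by rewrite divr_gt0// subr_gt0.
have dp := log_derive_powR (1 - gam e) (log_derive_mul (log_derive_cst p k0) dP).
by apply: (log_derive_cast (log_derive_mul (log_derive_powR (gam e) dC) dp)) => //; ring.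
Qed.

Lemma firm_foc_price (x : trajectory R) (t : int) : positive x ->
  let P := x t Price in let C := x (t - 1) PercCost in
  demand_markup P C < Mh e ->
  firm_foc e Price t x = x t Output
   - eps e * (x t MultDemand * goods_demand e x t P C / P)
   - (eps e - 1) * gam e *
       (x t MultDemand * goods_demand e x t P C / P * phi e (demand_markup P C))
   + (1 - gam e) * (x t MultPerc * law_of_motion e C P / P).
Proof.
move=> px P C mM; rewrite /firm_foc.
have P0 : 0 < P by exact: px.
have C0 : 0 < C by exact: px.
have dD := log_derive_demand
  (log_derive_cst P (px t Consumption isT)) (log_derive_cst P (px t PriceIndex isT))
  (log_derive_id P0) (log_derive_cst P C0) mM.
have dl := log_derive_law (log_derive_id P0) (log_derive_cst P C0).
have dg := is_derive_add (is_derive_add (is_derive_affine (x t Output) 0 P)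
  (is_derive_mul (is_derive_cst (x t MultDemand) P 1) (log_derive_derive dD)))
  (is_derive_mul (is_derive_cst (x t MultPerc) P 1) (log_derive_derive dl)).
pose g z := x t Output * z + 0 + x t MultDemand * goods_demand e x t z C
  + x t MultPerc * law_of_motion e C z.
rewrite (derive1_upto_cst (g := g) dg).
  rewrite /goods_demand -/(demand_markup P C) /=; generalize_atoms; ring.
near=> z; rewrite !firm_lagrangianE// /firm_term /set_at /= !dateE /= /g -/C.
by generalize_atoms; ring.
Unshelve. all: by end_near. Qed.

(** C^p of date t enters the date-t term only as the left side of the law of motion, whence
    [- x t MultPerc]. Its other effects are at t + 1, as the lagged reference cost in demand and in
    the next law of motion. *)
Lemma firm_foc_perccost (x : trajectory R) (t : int) : positive x ->
  let P := x (t + 1) Price in let C := x t PercCost in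
  demand_markup P C < Mh e ->
  firm_foc e PercCost t x = - x t MultPerc
   + (eps e - 1) * gam e * (sdf e x t 1 *
       (x (t + 1) MultDemand * goods_demand e x (t + 1) P C / C
        * phi e (demand_markup P C)))
   + gam e * (sdf e x t 1 * (x (t + 1) MultPerc * law_of_motion e C P / C)).
Proof.
move=> px P C mM; rewrite /firm_foc.
have P0 : 0 < P by exact: px.
have C0 : 0 < C by exact: px.
have dD := log_derive_demand (log_derive_cst C (px (t + 1) Consumption isT))
  (log_derive_cst C (px (t + 1) PriceIndex isT))
  (log_derive_cst C P0) (log_derive_id C0) mM.
have dl := log_derive_law (log_derive_cst C P0) (log_derive_id C0).
have dg := is_derive_add (is_derive_affine (- x t MultPerc) 0 C)
  (is_derive_mul (is_derive_cst (sdf e x t 1) C 1) (is_derive_add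
  (is_derive_mul (is_derive_cst (x (t + 1) MultDemand) C 1) (log_derive_derive dD))
  (is_derive_mul (is_derive_cst (x (t + 1) MultPerc) C 1) (log_derive_derive dl)))).
pose g z := - x t MultPerc * z + 0 + sdf e x t 1 *
  (x (t + 1) MultDemand * goods_demand e x (t + 1) P z
  + x (t + 1) MultPerc * law_of_motion e z P).
rewrite (derive1_upto_cst (g := g) dg).
  rewrite /goods_demand -/(demand_markup P C) /=; generalize_atoms; ring.
near=> z; rewrite !firm_lagrangianE// /firm_term /set_at /= !dateE /= /g -/P.
by generalize_atoms; ring.
Unshelve. all: by end_near. Qed.

End Conditions.

(** * Expansions around the steady state *)

Section Displaced.
Set Implicit Arguments.
Unset Strict Implicit.
Context {R : realType} (xbar h : trajectory R).
Hypothesis px : positive xbar.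

Lemma displaced_positive s : positive (displaced xbar h s).
Proof.
by move=> t v vl; rewrite /displaced (negbTE vl) mulr_gt0 ?expR_gt0// px.
Qed.

(** Along the displacement the deviation is exactly the logarithmic derivative, so in the expansions
    below each product of powers contributes its steady-state value times the corresponding linear
    combination of deviations. *)
Lemma log_derive_displaced t v : ~~ in_levels v ->
  log_derive 0 (fun s => displaced xbar h s t v) (xbar t v) (h t v).
Proof.
move=> vl; rewrite /displaced (negbTE vl).
by apply: log_derive_exp; exact: px.
Qed.

Lemma first_order_val g (f : R -> R) l : is_derive (0 : R) 1 f l ->
  (\forall s \near (0 : R), f s = g (displaced xbar h s)) ->
  first_order xbar g h = l.
Proof. by move=> df fg; exact: derive1_near df fg. Qed.

End Displaced.

Section Expansions.
Set Implicit Arguments.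
Unset Strict Implicit.
Context {R : realType} (e : economy R).
Variables (xbar h : trajectory R) (t : int).
Hypothesis px : positive xbar.

Let D (s : R) := displaced xbar h s.

Let pD s : positive (D s).
Proof. exact: displaced_positive. Qed.

Local Notation "'d[' t , v ]" := (@log_derive_displaced _ xbar h px t v isT).

Lemma first_order_labor : first_order xbar (household_foc e Labor t) h =
  xbar t MultBudget * xbar t Wage * (h t MultBudget + h t Wage)
  - xbar t Labor `^ Defs.eta e * (Defs.eta e * h t Labor)
  - xbar t MultLaborDem * h t MultLaborDem.
Proof.
apply: (first_order_val (is_derive_add (is_derive_add
  (log_derive_derive (log_derive_mul d[t, MultBudget] d[t, Wage]))
  (is_derive_opp (log_derive_derive (log_derive_powR (Defs.eta e) d[t, Labor]))))
  (is_derive_opp (log_derive_derive d[t, MultLaborDem])))).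
by near=> s; rewrite household_foc_labor.
Unshelve. all: by end_near. Qed.

Lemma first_order_wage : first_order xbar (household_foc e Wage t) h =
  xbar t MultBudget * xbar t Labor * (h t MultBudget + h t Labor)
  - nu e * (xbar t MultLaborDem * xbar t Labor / xbar t Wage
            * (h t MultLaborDem + h t Labor - h t Wage)).
Proof.
have d1 := log_derive_mul d[t, MultBudget] d[t, Labor].
have d2 := log_derive_mul (log_derive_mul d[t, MultLaborDem] d[t, Labor])
  (log_derive_inv d[t, Wage]).
have d3 := is_derive_add (log_derive_derive d1)
  (is_derive_opp (is_derive_mul (is_derive_cst (nu e) (0 : R) 1) (log_derive_derive d2))).
apply: (first_order_val (is_derive_cast d3 _)); first by rewrite mul0r add0r.
by near=> s; rewrite household_foc_wage//=; ring.
Unshelve. all: by end_near. Qed.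

Lemma first_order_purchase : first_order xbar (purchase_foc e `[0, 1] t) h =
  (xbar t Output)^-1 * (- h t Output)
  - xbar t MultBudget * xbar t Price * (h t MultBudget + h t Price).
Proof.
apply: (first_order_val (is_derive_add (log_derive_derive (log_derive_inv d[t, Output]))
  (is_derive_opp (log_derive_derive (log_derive_mul d[t, MultBudget] d[t, Price]))))).
by near=> s; rewrite purchase_foc_all.
Unshelve. all: by end_near. Qed.

Lemma first_order_output : first_order xbar (firm_foc e Output t) h =
  xbar t Price * h t Price - xbar t MultDemand * h t MultDemand
  - xbar t MultProd * h t MultProd.
Proof.
apply: (first_order_val (is_derive_add (is_derive_add (log_derive_derive d[t, Price])
  (is_derive_opp (log_derive_derive d[t, MultDemand])))
  (is_derive_opp (log_derive_derive d[t, MultProd])))).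
by near=> s; rewrite firm_foc_output.
Unshelve. all: by end_near. Qed.

Lemma first_order_hiring : first_order xbar (hiring_foc e `[0, 1] t) h =
  xbar t MultProd * (xbar t Technology * alpha e * xbar t Labor `^ (alpha e - 1))
  * (h t MultProd + h t Technology + (alpha e - 1) * h t Labor)
  - xbar t Wage * h t Wage.
Proof.
have a0 : 0 < alpha e by case/andP: (alpha_in01 e).
have d1 := log_derive_mul d[t, MultProd] (log_derive_mul
   (log_derive_mul d[t, Technology] (log_derive_cst (0 : R) a0))
   (log_derive_powR (alpha e - 1) d[t, Labor])).
apply: (first_order_val (is_derive_cast (is_derive_add (log_derive_derive d1)
  (is_derive_opp (log_derive_derive d[t, Wage]))) _)).
  by rewrite addr0 !addrA.
by near=> s; rewrite hiring_foc_all.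
Unshelve. all: by end_near. Qed.

Lemma first_order_prod : first_order xbar (firm_foc e MultProd t) h =
  xbar t Technology * xbar t Labor `^ alpha e * (h t Technology + alpha e * h t Labor)
  - xbar t Output * h t Output.
Proof.
apply: (first_order_val (is_derive_add (log_derive_derive (log_derive_mul d[t, Technology]
  (log_derive_powR (alpha e) d[t, Labor])))
  (is_derive_opp (log_derive_derive d[t, Output])))).
by near=> s; rewrite firm_foc_prod.
Unshelve. all: by end_near. Qed.

Lemma first_order_perc : first_order xbar (firm_foc e MultPerc t) h =
  law_of_motion e (xbar (t - 1) PercCost) (xbar t Price)
  * (gam e * h (t - 1) PercCost + (1 - gam e) * h t Price)
  - xbar t PercCost * h t PercCost.
Proof.
apply: (first_order_val (is_derive_add (log_derive_derive
  (log_derive_law e d[t, Price] d[t - 1, PercCost]))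
  (is_derive_opp (log_derive_derive d[t, PercCost])))).
by near=> s; rewrite firm_foc_perc.
Unshelve. all: by end_near. Qed.

(** The log-deviation of [goods_demand]. The date is a parameter because the condition for C^p needs
    it at [t + 1]. *)
Definition demand_dev (t' : int) : R :=
  h t' Consumption - eps e * (h t' Price - h t' PriceIndex)
  - (eps e - 1) * phi e (demand_markup e (xbar t' Price) (xbar (t' - 1) PercCost))
    * (gam e * (h t' Price - h (t' - 1) PercCost)).

Let dDemand t' : demand_markup e (xbar t' Price) (xbar (t' - 1) PercCost) < Mh e ->
  log_derive 0 (fun s => goods_demand e (D s) t' (D s t' Price) (D s (t' - 1) PercCost))
    (goods_demand e xbar t' (xbar t' Price) (xbar (t' - 1) PercCost)) (demand_dev t').
Proof.
by move=> mM; exact: (log_derive_demand d[t', Consumption] d[t', PriceIndex]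
  d[t', Price] d[t' - 1, PercCost] mM).
Qed.

Let dMarkup t' : log_derive 0
  (fun s => demand_markup e (D s t' Price) (D s (t' - 1) PercCost))
  (demand_markup e (xbar t' Price) (xbar (t' - 1) PercCost))
  (gam e * (h t' Price - h (t' - 1) PercCost)).
Proof.
have e1 := eps_gt1 e; have e0 := lt_trans ltr01 e1.
have cst0 : 0 < (eps e / (eps e - 1)) `^ (1 - gam e).
  by rewrite powR_gt0// divr_gt0// subr_gt0.
have := log_derive_mul (log_derive_cst 0 cst0) (log_derive_powR (gam e)
  (log_derive_mul d[t', Price] (log_derive_inv d[t' - 1, PercCost]))).
by rewrite add0r.
Qed.

(** The closed forms of the price and C^p conditions hold only below [Mh e]. The strict inequality
    at the steady state persists for small displacements, which is enough for a derivative at 0. *)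
Let near_markup t' : demand_markup e (xbar t' Price) (xbar (t' - 1) PercCost) < Mh e ->
  \forall s \near (0 : R), demand_markup e (D s t' Price) (D s (t' - 1) PercCost) < Mh e.
Proof.
move=> mM; have m0 : 0 < demand_markup e (xbar t' Price) (xbar (t' - 1) PercCost).
  by case: (dMarkup t').
have := log_derive_near (dMarkup t') (b := 0) (c := Mh e).
rewrite m0 mM => /(_ isT); apply: filterS => s.
by case/andP.
Qed.

(** Here [sigma] enters: the conditions for the price and for C^p contain [phi] itself, and
    expanding them differentiates it once more. *)
Let dphi t' : demand_markup e (xbar t' Price) (xbar (t' - 1) PercCost) < Mh e ->
  let m := demand_markup e (xbar t' Price) (xbar (t' - 1) PercCost) in
  log_derive 0 (fun s => phi e (demand_markup e (D s t' Price) (D s (t' - 1) PercCost)))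
    (phi e m) (sigma e m * (gam e * (h t' Price - h (t' - 1) PercCost))).
Proof.
move=> mM m; have m0 : 0 < m by case: (dMarkup t').
have m01 : 0 < m < Mh e by rewrite m0 mM.
have [f0 s0 _ df] := phi_facts m01.
exact: (log_derive_comp (dMarkup t') f0 erefl df).
Qed.

Lemma first_order_demand :
  demand_markup e (xbar t Price) (xbar (t - 1) PercCost) < Mh e ->
  first_order xbar (firm_foc e MultDemand t) h =
  goods_demand e xbar t (xbar t Price) (xbar (t - 1) PercCost) * demand_dev t
  - xbar t Output * h t Output.
Proof.
move=> mM; apply: (first_order_val (is_derive_add (log_derive_derive (dDemand mM))
  (is_derive_opp (log_derive_derive d[t, Output])))).
by near=> s; rewrite firm_foc_demand.
Unshelve. all: by end_near. Qed.

Lemma first_order_price :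
  let P := xbar t Price in let C := xbar (t - 1) PercCost in
  let m := demand_markup e P C in
  let K := xbar t MultDemand * goods_demand e xbar t P C / P in
  m < Mh e ->
  first_order xbar (firm_foc e Price t) h =
  xbar t Output * h t Output
  - eps e * (K * (h t MultDemand + demand_dev t - h t Price))
  - (eps e - 1) * gam e * (K * phi e m * (h t MultDemand + demand_dev t - h t Price
      + sigma e m * (gam e * (h t Price - h (t - 1) PercCost))))
  + (1 - gam e) * (xbar t MultPerc * law_of_motion e C P / P
      * (h t MultPerc + (gam e * h (t - 1) PercCost + (1 - gam e) * h t Price)
         - h t Price)).
Proof.
move=> P C m K mM.
have dK := log_derive_mul (log_derive_mul d[t, MultDemand] (dDemand mM))
  (log_derive_inv d[t, Price]).
have dKp := log_derive_mul dK (dphi mM).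
have dL := log_derive_mul (log_derive_mul d[t, MultPerc]
   (log_derive_law e d[t, Price] d[t - 1, PercCost])) (log_derive_inv d[t, Price]).
have dcst c f l (df : is_derive (0 : R) 1 f l) :=
  is_derive_mul (is_derive_cst c (0 : R) 1) df.
apply: (first_order_val (is_derive_cast (is_derive_add (is_derive_add (is_derive_add
  (log_derive_derive d[t, Output])
  (is_derive_opp (dcst (eps e) _ _ (log_derive_derive dK))))
  (is_derive_opp (dcst ((eps e - 1) * gam e) _ _ (log_derive_derive dKp))))
  (dcst (1 - gam e) _ _ (log_derive_derive dL))) _)).
  by rewrite !mul0r !add0r.
near=> s; rewrite firm_foc_price//.
by near: s; exact: near_markup.
Unshelve. all: by end_near. Qed.

Lemma first_order_perccost :
  let P := xbar (t + 1) Price in let C := xbar t PercCost in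
  let m := demand_markup e P C in
  let K := sdf e xbar t 1 *
     (xbar (t + 1) MultDemand * goods_demand e xbar (t + 1) P C / C) in
  let sd := h t PriceIndex + h t Consumption
            - (h (t + 1) PriceIndex + h (t + 1) Consumption) in
  m < Mh e ->
  first_order xbar (firm_foc e PercCost t) h =
  - (xbar t MultPerc * h t MultPerc)
  + (eps e - 1) * gam e * (K * phi e m * (sd + h (t + 1) MultDemand
      + demand_dev (t + 1) - h t PercCost
      + sigma e m * (gam e * (h (t + 1) Price - h t PercCost))))
  + gam e * (sdf e xbar t 1 * (xbar (t + 1) MultPerc * law_of_motion e C P / C)
      * (sd + h (t + 1) MultPerc
         + (gam e * h t PercCost + (1 - gam e) * h (t + 1) Price) - h t PercCost)).
Proof.
move=> P C m K sd mM.
have tK : t + 1 - 1 = t by rewrite addrK.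
have dD : log_derive 0
  (fun s => goods_demand e (D s) (t + 1) (D s (t + 1) Price) (D s t PercCost))
    (goods_demand e xbar (t + 1) P C) (demand_dev (t + 1)).
  by have := @dDemand (t + 1); rewrite tK; apply.
have dp := @dphi (t + 1); rewrite tK in dp; have {}dp := dp mM.
have nm := @near_markup (t + 1); rewrite tK in nm; have {}nm := nm mM.
have de0 : 0 < delta e by case/andP: (delta_in01 e).
have dS : log_derive 0 (fun s => sdf e (D s) t 1) (sdf e xbar t 1) sd.
  have dd := log_derive_mul (log_derive_cst (0 : R) de0) (log_derive_mul
    (log_derive_mul d[t, PriceIndex] d[t, Consumption])
    (log_derive_inv (log_derive_mul d[t + 1, PriceIndex] d[t + 1, Consumption]))).
  rewrite (funext (fun s => sdf1 e (D s) t)) sdf1.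
  by apply: (log_derive_cast dd); rewrite ?add0r.
have dK := log_derive_mul dS (log_derive_mul (log_derive_mul (log_derive_mul
  d[t + 1, MultDemand] dD) (log_derive_inv d[t, PercCost])) dp).
have dL := log_derive_mul dS (log_derive_mul (log_derive_mul d[t + 1, MultPerc]
   (log_derive_law e d[t + 1, Price] d[t, PercCost])) (log_derive_inv d[t, PercCost])).
have dcst c f l (df : is_derive (0 : R) 1 f l) :=
  is_derive_mul (is_derive_cst c (0 : R) 1) df.
apply: (first_order_val (is_derive_cast (is_derive_add (is_derive_add
  (is_derive_opp (log_derive_derive d[t, MultPerc]))
  (dcst ((eps e - 1) * gam e) _ _ (log_derive_derive dK)))
  (dcst (gam e) _ _ (log_derive_derive dL))) _)).
  rewrite !mul0r !add0r -/m /K.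
  generalize (demand_dev (t + 1)) sd (sdf e xbar t 1) => dd sd' S1.
  by rewrite /P /C /=; generalize_atoms; ring.
near=> s; rewrite firm_foc_perccost//.
by near: s; exact: nm.
Unshelve. all: by end_near. Qed.

End Expansions.

(** * The linear algebra of the Phillips curve *)

Section Algebra.
Set Implicit Arguments.
Unset Strict Implicit.
Context {R : realFieldType}.

(** Wage setting fixes the wage markup, so labor supply reads l + w = eta n. Purchases give y + l +
    p = 0, hiring o + a + (alpha - 1) n = w, production a + alpha n = y; eliminating l, w, y and a
    leaves o - p, from which alpha and technology have disappeared. *)
Lemma markup_algebra (eta alpha nu lam W B mu N Y P A1 B1 l w n m y p o a : R) :
  0 < lam -> 0 < W -> 0 < N -> 0 < B -> 0 < Y ->
  lam * W - B - mu = 0 -> lam * N - mu * (nu * N / W) = 0 ->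
  Y^-1 - lam * P = 0 -> A1 - W = 0 -> B1 - Y = 0 ->
  lam * W * (l + w) - B * (eta * n) - mu * m = 0 ->
  lam * N * (l + n) - nu * (mu * N / W * (m + n - w)) = 0 ->
  Y^-1 * (- y) - lam * P * (l + p) = 0 ->
  A1 * (o + a + (alpha - 1) * n) - W * w = 0 ->
  B1 * (a + alpha * n) - Y * y = 0 ->
  o - p = (1 + eta) * n.
Proof.
move=> lam0 W0 N0 B0 Y0 s1 s2 s3 s4 s5 h1 h2 h3 h4 h5.
have {s4}sA : A1 = W by lra.
have {s5}sB : B1 = Y by lra.
have {s1}sm : mu = lam * W - B by lra.
have e2 : m = l + w.
  have : lam * N * (l + w - m) = 0.
    rewrite -{}[RHS]h2.
    have -> : nu * (mu * N / W * (m + n - w)) = mu * (nu * N / W) * (m + n - w) by ring.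
    by have -> : mu * (nu * N / W) = lam * N; [lra|ring].
  by move/eqP; rewrite !mulf_eq0 (gt_eqF lam0) (gt_eqF N0) /= => /eqP; lra.
have e1 : l + w = eta * n.
  have : B * (l + w - eta * n) = 0 by rewrite -{}[RHS]h1 e2 sm; ring.
  by move/eqP; rewrite mulf_eq0 (gt_eqF B0) /= => /eqP; lra.
have e3 : y + l + p = 0.
  have : Y^-1 * (y + l + p) = 0.
    have s3' : lam * P = Y^-1 by lra.
    by rewrite s3' in h3; rewrite -[RHS]oppr0 -h3; ring.
  by move/eqP; rewrite mulf_eq0 invr_eq0 (gt_eqF Y0) /= => /eqP.
have e4 : o + a + (alpha - 1) * n = w.
  have : W * (o + a + (alpha - 1) * n - w) = 0 by rewrite -{}[RHS]h4 sA; ring.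
  by move/eqP; rewrite mulf_eq0 (gt_eqF W0) /= => /eqP; lra.
have e5 : a + alpha * n = y.
  have : Y * (a + alpha * n - y) = 0 by rewrite -{}[RHS]h5 sB; ring.
  by move/eqP; rewrite mulf_eq0 (gt_eqF Y0) /= => /eqP; lra.
by lra.
Qed.

(* [K] and [U] stand for kappa Y / P and chi C^p / P at the steady state; lower
   case letters are log-deviations, primed at date t + 1. *)
Lemma phillips_algebra (eps gam de eta phi sig K U n mp y p k q cp
    n' mp' y' p' k' q' cp' pi' : R) :
  0 < gam < 1 -> 0 < de < 1 -> 0 < phi -> 0 < sig -> 1 < eps ->
  let Kf := 1 + (1 - de) * gam / (1 - de * gam) * phi in
  U = (eps - 1) * gam * phi * de * K + gam * de * U ->
  k - p = - ((eps - 1) * Kf * ((1 + eta) * n)) ->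
  k' - p' = - ((eps - 1) * Kf * ((1 + eta) * n')) ->
  (1 - gam) * (U * (q + cp - p - y)) =
    K * ((eps + (eps - 1) * gam * phi) * (k - p) + (eps - 1) * gam * phi * sig * mp) ->
  (1 - gam) * (U * (q' + cp' - p' - y')) =
    K * ((eps + (eps - 1) * gam * phi) * (k' - p') + (eps - 1) * gam * phi * sig * mp') ->
  mp' = gam * (pi' + mp) ->
  - (U * q) + (eps - 1) * gam * phi * de * K * (p + y - cp + (k' - p') + sig * mp')
    + gam * de * U * (p + y - cp + (q' + cp' - p' - y'))
  = K * (eps - 1) * gam * phi * sig / (1 - gam) *
    (- ((1 - de * gam) * mp)
     + (1 + eta) * ((eps + (eps - 1) * gam * phi) / (gam * phi * sig)) * Kf * n
     + de * gam * pi'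
     - (1 + eta) * de * ((eps + (eps - 1) * phi) / (phi * sig)) * Kf * n').
Proof.
move=> /andP[g0 g1] /andP[d0 d1] f0 s0 e1 Kf hU hk hk' hp hp' hm.
have g1' : 1 - gam != 0 by rewrite subr_eq0 gt_eqF.
(* The factor 1 - gam is what the price conditions [hp] and [hp'] carry. *)
apply: (mulfI g1').
(* Completing q to q + c^p - p - y, the combination determined by the price condition, leaves p + y
   - c^p times a factor that vanishes by [hU]. *)
have -> : - (U * q) + (eps - 1) * gam * phi * de * K * (p + y - cp + (k' - p') + sig * mp')
    + gam * de * U * (p + y - cp + (q' + cp' - p' - y'))
  = - (U * (q + cp - p - y)) + (eps - 1) * gam * phi * de * K * ((k' - p') + sig * mp')
    + gam * de * (U * (q' + cp' - p' - y')) +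
    (p + y - cp) * ((eps - 1) * gam * phi * de * K + gam * de * U - U) by ring.
rewrite -hU subrr mulr0 addr0.
have distr (v v' A : R) : (1 - gam) * (- v + A + gam * de * v')
  = - ((1 - gam) * v) + (1 - gam) * A + gam * de * ((1 - gam) * v') by ring.
(* The weights on k' - p' are (1 - gam)(eps - 1) phi and eps + (eps - 1) gam phi, up to the common
   factor gam de K; their sum is eps + (eps - 1) phi. The weights on mp' add up likewise, to (eps -
   1) gam phi de sig K. *)
rewrite distr hp hp' hk hk' hm; generalize Kf => Kf'.
field.
by rewrite g1' !gt_eqF.
Qed.

(** Both conclusions are expansions from which a multiple of the matching steady-state equation is
    subtracted: y times the price equation, and p times the output equation. Only deviations
    relative to p and y survive. *)
Lemma price_algebra (eps gam phi sig eta kap om P Y chi Cp k p o y q cp cp_ mp dd n : R) :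
  P - kap - om = 0 -> P * p - kap * k - om * o = 0 ->
  Y - eps * (kap * Y / P) - (eps - 1) * gam * (kap * Y / P * phi)
    + (1 - gam) * (chi * Cp / P) = 0 ->
  dd = y -> gam * cp_ + (1 - gam) * p = cp -> p - cp = mp ->
  Y * y - eps * (kap * Y / P * (k + dd - p))
  - (eps - 1) * gam * (kap * Y / P * phi * (k + dd - p + sig * (gam * (p - cp_))))
  + (1 - gam) * (chi * Cp / P * (q + (gam * cp_ + (1 - gam) * p) - p)) = 0 ->
  (1 - gam) * (chi * Cp / P * (q + cp - p - y)) =
   kap * Y / P * ((eps + (eps - 1) * gam * phi) * (k - p) + (eps - 1) * gam * phi * sig * mp)
  /\ (o - p = (1 + eta) * n -> kap * (k - p) = - (om * ((1 + eta) * n))).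
Proof.
move=> s1 h1 s2 hd hl hm h2; split.
  have hmp : gam * (p - cp_) = mp by lra.
  move: h2; rewrite hmp hl hd; move: s2; set K := kap * Y / P; set U := chi * Cp / P.
  (* The steady-state price equation is scaled by y, so that it cancels the terms in which output
     deviations stand alone. *)
  by move=> /(congr1 ( *%R y)); rewrite mulr0 => s2 h2; lra.
move=> <-; apply/eqP; rewrite -subr_eq0 -[X in _ == X]oppr0 -h1; apply/eqP.
have -> : P = kap + om by lra.
by ring.
Qed.
End Algebra.

(** * Expansions of the identities *)

Section Identities.
Set Implicit Arguments.
Unset Strict Implicit.
Context {R : realType} (e : economy R).
Variables (xbar h : trajectory R) (t : int).
Hypothesis px : positive xbar.

Let pD s : positive (displaced xbar h s).
Proof. exact: displaced_positive. Qed.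

Local Notation "'d[' t , v ]" := (@log_derive_displaced _ xbar h px t v isT).

(** This and the next three definitions name functions from the constructors of [identity], up to
    conversion, so that their expansions can be stated and rewritten. *)
Definition markup_identity (x : trajectory R) :=
  x t PercMarkup - x t Price / x t PercCost.

Definition price_index_identity (x : trajectory R) :=
  x t PriceIndex - ces (1 - eps e) (fun=> x t Price / x t Fairness).

Definition consumption_identity (x : trajectory R) :=
  x t Consumption - int01 (fun=> ces ((eps e - 1) / eps e)
                                   (fun=> x t Fairness * x t Output)).

Definition inflation_identity (x : trajectory R) :=
  x t Inflation - ln (x t Price / x (t - 1) Price).

Lemma first_order_markup : first_order xbar markup_identity h =
  xbar t PercMarkup * h t PercMarkup
  - xbar t Price / xbar t PercCost * (h t Price - h t PercCost).
Proof.
apply: (first_order_val (is_derive_add (log_derive_derive d[t, PercMarkup])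
  (is_derive_opp (log_derive_derive (log_derive_mul d[t, Price]
     (log_derive_inv d[t, PercCost])))))).
by near=> s.
Unshelve. all: by end_near. Qed.

Lemma price_indexE x : positive x -> price_index_identity x =
  x t PriceIndex - x t Price / x t Fairness.
Proof.
move=> p; rewrite /price_index_identity.
have e1 := eps_gt1 e.
by rewrite (ces_cst (a := x t Price / x t Fairness))// ?divr_gt0 ?p// subr_eq0 lt_eqF.
Qed.

Lemma consumptionE x : positive x -> consumption_identity x =
  x t Consumption - x t Fairness * x t Output.
Proof.
move=> p; rewrite /consumption_identity; congr (_ - _).
apply: int01_cst => j _; apply: ces_cst => //; first exact: ces_eps_neq0.
by rewrite mulr_gt0// p.
Qed.

Lemma first_order_price_index : first_order xbar price_index_identity h =
  xbar t PriceIndex * h t PriceIndex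
  - xbar t Price / xbar t Fairness * (h t Price - h t Fairness).
Proof.
apply: (first_order_val (is_derive_add (log_derive_derive d[t, PriceIndex])
  (is_derive_opp (log_derive_derive (log_derive_mul d[t, Price]
     (log_derive_inv d[t, Fairness])))))).
by near=> s; rewrite price_indexE.
Unshelve. all: by end_near. Qed.

Lemma first_order_consumption : first_order xbar consumption_identity h =
  xbar t Consumption * h t Consumption
  - xbar t Fairness * xbar t Output * (h t Fairness + h t Output).
Proof.
apply: (first_order_val (is_derive_add (log_derive_derive d[t, Consumption])
  (is_derive_opp (log_derive_derive (log_derive_mul d[t, Fairness] d[t, Output]))))).
by near=> s; rewrite consumptionE.
Unshelve. all: by end_near. Qed.

Lemma first_order_inflation : first_order xbar inflation_identity h =
  h t Inflation - (h t Price - h (t - 1) Price).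
Proof.
have dP := log_derive_mul d[t, Price] (log_derive_inv d[t - 1, Price]).
have [q0 Q0 _] := dP.
have dl := is_derive_chain (is_derive1_ln Q0) (log_derive_derive dP) q0.
apply: (first_order_val (is_derive_cast (is_derive_add
  (is_derive_affine (h t Inflation) (xbar t Inflation) (0 : R)) (is_derive_opp dl)) _)).
  by rewrite mulKf ?gt_eqF.
near=> s; rewrite /inflation_identity [displaced _ _ _ _ Inflation]/displaced /=.
by rewrite (mulrC s) [xbar t Inflation + _]addrC.
Unshelve. all: by end_near. Qed.

End Identities.

(** * Growth and perceived markup in the steady state *)

Section SteadyState.
Set Implicit Arguments.
Unset Strict Implicit.
Context {R : realType} (e : economy R) (pibar : R) (xbar : trajectory R).
Hypothesis st : steady_state e pibar xbar.

Lemma steady_positive : positive xbar.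
Proof. by case: st. Qed.

Let px := steady_positive.

Let opt t g : optimality e t g -> g xbar = 0.
Proof. by move=> o; case: st => _ _ _; apply; left; exact: o. Qed.

Let idy t g : identity e t g -> g xbar = 0.
Proof. by move=> o; case: st => _ _ _; apply; right; exact: o. Qed.

Lemma steady_next (t : int) v :
  xbar (t + 1) v = xbar t v * expR ((nominal_degree v)%:~R * pibar).
Proof.
case: st => _ gr _ _; rewrite (gr (t + 1) v) (gr t v) -[RHS]mulrA -expRD; congr (_ * expR _).
by rewrite intrD; ring.
Qed.

Lemma steady_real (t : int) v : nominal_degree v = 0 -> xbar t v = xbar 0 v.
Proof. by case: st => _ gr _ _ v0; rewrite gr v0 !mul0r expR0 mulr1. Qed.

Lemma steady_law (t : int) :
  law_of_motion e (xbar (t - 1) PercCost) (xbar t Price) = xbar t PercCost.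
Proof.
have := opt (@opt_firm R e t MultPerc isT).
by rewrite firm_foc_perc// => /eqP; rewrite subr_eq0 => /eqP.
Qed.

Lemma powRV (a r : R) : 0 < a -> a^-1 `^ r = (a `^ r)^-1.
Proof.
move=> a0; have ar : a `^ r != 0 by rewrite gt_eqF ?powR_gt0.
apply: (mulfI ar); rewrite mulfV// -powRM ?invr_ge0 ?ltW//.
by rewrite mulfV ?gt_eqF// powR1.
Qed.

(** Substituting the law of motion into P / C^p gives the argument of [Fair e] in the demand. Being
    real it is the same at all dates, so [phi] and [sigma] are evaluated at a single point. *)
Lemma steady_markup (t : int) :
  demand_markup e (xbar t Price) (xbar (t - 1) PercCost) = xbar 0 PercMarkup.
Proof.
have e1 := eps_gt1 e; have e0 := lt_trans ltr01 e1.
have k0 : 0 < eps e / (eps e - 1) by rewrite divr_gt0// subr_gt0.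
have -> : xbar 0 PercMarkup = xbar t Price / xbar t PercCost.
  rewrite -(steady_real t)//; apply/eqP; rewrite -subr_eq0; apply/eqP.
  exact: (idy (id_perceived_markup e t)).
have P0 : 0 < xbar t Price by exact: px.
have C0 : 0 < xbar (t - 1) PercCost by exact: px.
rewrite -(steady_law t) /law_of_motion /demand_markup.
rewrite -[(eps e - 1) / eps e]invf_div.
move: (eps e / (eps e - 1)) k0 => k k0; have kV0 : 0 < k^-1 by rewrite invr_gt0.
have CV0 : 0 < (xbar (t - 1) PercCost)^-1 by rewrite invr_gt0.
rewrite (powRM _ (ltW P0) (ltW CV0)) (powRM _ (ltW kV0) (ltW P0)) !powRV//.
rewrite [xbar t Price `^ (1 - _)]powRB ?(gt_eqF P0) ?implybT// (powRr1 (ltW P0)).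
have a1 : k `^ (1 - gam e) != 0 by rewrite gt_eqF ?powR_gt0.
have a2 : xbar (t - 1) PercCost `^ gam e != 0 by rewrite gt_eqF ?powR_gt0.
have a3 : xbar t Price `^ gam e != 0 by rewrite gt_eqF ?powR_gt0.
by field; rewrite a1 a2 a3 (gt_eqF P0).
Qed.

End SteadyState.

(** * The steady state and the linearized economy *)

Section Phillips.
Set Implicit Arguments.
Unset Strict Implicit.
Context {R : realType} (e : economy R) (pibar : R) (xbar : trajectory R).
Hypothesis st : steady_state e pibar xbar.
Hypothesis mM : xbar 0 PercMarkup < Mh e.

Let px : positive xbar := steady_positive st.

Let opt t g : optimality e t g -> g xbar = 0.
Proof. by move=> o; case: st => _ _ _; apply; left; exact: o. Qed.

Let idy t g : identity e t g -> g xbar = 0.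
Proof. by move=> o; case: st => _ _ _; apply; right; exact: o. Qed.

Let m := xbar 0 PercMarkup.

Let mMt (t : int) : demand_markup e (xbar t Price) (xbar (t - 1) PercCost) < Mh e.
Proof. by rewrite (steady_markup st). Qed.

Lemma steady_demand (t : int) :
  goods_demand e xbar t (xbar t Price) (xbar (t - 1) PercCost) = xbar t Output.
Proof.
have := opt (@opt_firm R e t MultDemand isT).
by rewrite firm_foc_demand// => /eqP; rewrite subr_eq0 => /eqP.
Qed.

Let itv01 : measurable (`[0, 1] : set R) /\ `[0, 1] `<=` (`[0, 1] : set R).
Proof. by split. Qed.

(** The expansions that hold path by path: they involve dates [t] and [t - 1] only, so no
    expectation remains. The condition for C^p is kept apart because it reaches [t + 1]. *)
Record static_equilibrium (h : trajectory R) (t : int) : Prop := {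
  static_labor : first_order xbar (household_foc e Labor t) h = 0;
  static_wage : first_order xbar (household_foc e Wage t) h = 0;
  static_purchase : first_order xbar (purchase_foc e `[0, 1] t) h = 0;
  static_output : first_order xbar (firm_foc e Output t) h = 0;
  static_hiring : first_order xbar (hiring_foc e `[0, 1] t) h = 0;
  static_prod : first_order xbar (firm_foc e MultProd t) h = 0;
  static_perc : first_order xbar (firm_foc e MultPerc t) h = 0;
  static_demand : first_order xbar (firm_foc e MultDemand t) h = 0;
  static_price : first_order xbar (firm_foc e Price t) h = 0;
  static_markup : first_order xbar (markup_identity t) h = 0;
  static_price_index : first_order xbar (price_index_identity e t) h = 0;
  static_consumption : first_order xbar (consumption_identity e t) h = 0 }.

Section Static.
Variables (h : trajectory R) (t : int).
Hypothesis S : static_equilibrium h t.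

Lemma static_real_markup :
  h t MultProd - h t Price = (1 + Defs.eta e) * h t Labor.
Proof.
have s1 := opt (@opt_household R e t Labor isT).
rewrite household_foc_labor// in s1.
have s2 := opt (@opt_household R e t Wage isT).
rewrite household_foc_wage// in s2.
have s3 := opt (opt_purchase e t itv01.1 itv01.2).
rewrite purchase_foc_all// in s3.
have s4 := opt (opt_hiring e t itv01.1 itv01.2).
rewrite hiring_foc_all// in s4.
have s5 := opt (@opt_firm R e t MultProd isT).
rewrite firm_foc_prod// in s5.
have := static_labor S; have := static_wage S; have := static_purchase S.
have := static_hiring S; have := static_prod S.
rewrite first_order_labor// first_order_wage// first_order_purchase//.
rewrite first_order_hiring// first_order_prod//.
move=> h5 h4 h3 h2 h1.
apply: (markup_algebra _ _ _ _ _ s1 s2 s3 s4 s5 h1 h2 h3 h4 h5); try exact: px.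
by rewrite powR_gt0 ?px.
Qed.

Lemma static_perceived_markup :
  h t Price - h t PercCost = h t PercMarkup.
Proof.
have := static_markup S; rewrite first_order_markup//.
have := idy (id_perceived_markup e t) => /eqP; rewrite subr_eq0 => /eqP <-.
have M0 : 0 < xbar t PercMarkup by exact: px.
by rewrite -mulrBr => /eqP; rewrite mulf_eq0 (gt_eqF M0) /= subr_eq0 => /eqP.
Qed.

Lemma static_law : gam e * h (t - 1) PercCost + (1 - gam e) * h t Price = h t PercCost.
Proof.
have := static_perc S; rewrite first_order_perc// (steady_law st).
have C0 : 0 < xbar t PercCost by exact: px.
by rewrite -mulrBr => /eqP; rewrite mulf_eq0 (gt_eqF C0) /= subr_eq0 => /eqP.
Qed.

Lemma static_demand_dev : demand_dev e xbar h t = h t Output.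
Proof.
have := static_demand S; rewrite first_order_demand// steady_demand.
have C0 : 0 < xbar t Output by exact: px.
by rewrite -mulrBr => /eqP; rewrite mulf_eq0 (gt_eqF C0) /= subr_eq0 => /eqP.
Qed.

(** X = P / F and Z = F Y, so fairness cancels in X Z and the stochastic discount factor depends on
    nominal spending alone. *)
Lemma static_spending :
  h t PriceIndex + h t Consumption = h t Price + h t Output.
Proof.
have := static_price_index S; rewrite first_order_price_index//.
have := idy (id_price_index e t); rewrite -/(price_index_identity e t xbar).
rewrite price_indexE// => /eqP; rewrite subr_eq0 => /eqP <-.
have X0 : 0 < xbar t PriceIndex by exact: px.
rewrite -mulrBr => /eqP; rewrite mulf_eq0 (gt_eqF X0) /= subr_eq0 => /eqP ->.
have := static_consumption S; rewrite first_order_consumption//.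
have := idy (id_consumption e t); rewrite -/(consumption_identity e t xbar).
rewrite consumptionE// => /eqP; rewrite subr_eq0 => /eqP <-.
have Z0 : 0 < xbar t Consumption by exact: px.
rewrite -mulrBr => /eqP; rewrite mulf_eq0 (gt_eqF Z0) /= subr_eq0 => /eqP ->.
by ring.
Qed.

Lemma steady_price_eq : xbar t Output
  - eps e * (xbar t MultDemand * xbar t Output / xbar t Price)
  - (eps e - 1) * gam e * (xbar t MultDemand * xbar t Output / xbar t Price * phi e m)
  + (1 - gam e) * (xbar t MultPerc * xbar t PercCost / xbar t Price) = 0.
Proof.
have := opt (@opt_firm R e t Price isT); rewrite firm_foc_price//.
by rewrite (steady_markup st) steady_demand (steady_law st).
Qed.

Lemma steady_output_eq : xbar t Price - xbar t MultDemand - xbar t MultProd = 0.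
Proof. by have := opt (@opt_firm R e t Output isT); rewrite firm_foc_output. Qed.

Lemma static_pricing :
  (1 - gam e) * (xbar t MultPerc * xbar t PercCost / xbar t Price
      * (h t MultPerc + h t PercCost - h t Price - h t Output))
  = xbar t MultDemand * xbar t Output / xbar t Price
    * ((eps e + (eps e - 1) * gam e * phi e m) * (h t MultDemand - h t Price)
       + (eps e - 1) * gam e * phi e m * sigma e m * h t PercMarkup)
  /\ xbar t MultDemand * (h t MultDemand - h t Price)
     = - (xbar t MultProd * ((1 + Defs.eta e) * h t Labor)).
Proof.
have h1 := static_output S; rewrite first_order_output// in h1.
have h2 := static_price S; rewrite first_order_price// in h2.
rewrite (steady_markup st) steady_demand (steady_law st) in h2.
have [p1 p2] := price_algebra (Defs.eta e) (h t Labor) steady_output_eq h1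
  steady_price_eq static_demand_dev static_law static_perceived_markup h2.
by split; [exact: p1|exact: p2 static_real_markup].
Qed.

End Static.

(** In the steady state the discount factor is delta deflated by one period of inflation, which
    exactly undoes the growth of nominal quantities. *)
Lemma steady_ratios (t : int) :
  [/\ sdf e xbar t 1 * xbar (t + 1) MultDemand = delta e * xbar t MultDemand,
      xbar (t + 1) Output = xbar t Output,
      xbar (t + 1) MultPerc = xbar t MultPerc,
      sdf e xbar t 1 * xbar (t + 1) PercCost = delta e * xbar t PercCost &
      xbar (t + 1) MultDemand / xbar (t + 1) Price = xbar t MultDemand / xbar t Price
      /\ xbar (t + 1) PercCost / xbar (t + 1) Price = xbar t PercCost / xbar t Price].
Proof.
rewrite sdf1 !(steady_next st) /= !mul0r expR0 !mulr1 !mul1r.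
have g0 : expR pibar != 0 by rewrite gt_eqF ?expR_gt0.
have X0 := lt0r_neq0 (@px t PriceIndex isT).
have Z0 := lt0r_neq0 (@px t Consumption isT).
have P0 := lt0r_neq0 (@px t Price isT).
have D0 := lt0r_neq0 (@px t MultDemand isT).
move: (expR pibar) g0 X0 Z0 P0 D0 => G.
move: (xbar t PriceIndex) (xbar t Consumption) (xbar t Price) (xbar t MultDemand).
move=> X Z P D G0 X0 Z0 P0 D0.
split=> //; last split; field; rewrite ?G0 ?X0 ?Z0 ?P0 ?D0 //.
Qed.


Let m_itv : 0 < m < Mh e.
Proof. by rewrite mM andbT; exact: px. Qed.

Let Kf := 1 + (1 - delta e) * gam e / (1 - delta e * gam e) * phi e m.

(** The steady-state condition for C^p as a recursion for its shadow value relative to P: next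
    period's marginal effect on demand, plus the share gam that carries over. *)
Lemma steady_perc_value (t : int) :
  let K := xbar t MultDemand * xbar t Output / xbar t Price in
  let U := xbar t MultPerc * xbar t PercCost / xbar t Price in
  U = (eps e - 1) * gam e * phi e m * delta e * K + gam e * delta e * U.
Proof.
have := opt (@opt_firm R e t PercCost isT).
have mn := steady_markup st (t + 1); rewrite addrK -/m in mn.
have dn := steady_demand (t + 1); rewrite addrK in dn.
have ln' := steady_law st (t + 1); rewrite addrK in ln'.
rewrite firm_foc_perccost// mn// dn ln'.
have [r1 -> -> r4 _] := steady_ratios t.
have C0 := lt0r_neq0 (@px t PercCost isT).
have P0 := lt0r_neq0 (@px t Price isT).
rewrite /=.
have -> : sdf e xbar t 1 * (xbar (t + 1) MultDemand * xbar t Output / xbar t PercCost * phi e m)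
  = (sdf e xbar t 1 * xbar (t + 1) MultDemand) * (xbar t Output / xbar t PercCost * phi e m).
  by rewrite !mulrA.
have -> : sdf e xbar t 1 * (xbar t MultPerc * xbar (t + 1) PercCost / xbar t PercCost)
  = (sdf e xbar t 1 * xbar (t + 1) PercCost) * (xbar t MultPerc / xbar t PercCost).
  by generalize (sdf e xbar t 1) => S; generalize_atoms; ring.
rewrite r1 r4; move: C0 P0; generalize (phi e m) => f.
move: (xbar t PercCost) (xbar t Price) (xbar t MultPerc) (xbar t MultDemand) (xbar t Output).
move=> C P X D Y C0 P0 H.
(* The raw condition is per unit of C^p; the factor [C / P] turns it into a relation between [K] and
   [U]. *)
have : (- X + (eps e - 1) * gam e * (delta e * D * (Y / C * f)) +
   gam e * (delta e * C * (X / C))) * (C / P) = 0 by rewrite H mul0r.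
move=> {}H; apply/eqP; rewrite -subr_eq0 -[X in _ == X]oppr0 -H; apply/eqP.
by field; rewrite C0 P0.
Qed.

(** Solving the recursion for U and inserting it in the price equation determines P / kappa;
    subtracting 1 gives omega / kappa, and the bracket [Kf] emerges. *)
Lemma steady_markup_ratio (t : int) :
  xbar t MultProd / xbar t MultDemand = (eps e - 1) * Kf.
Proof.
have := steady_price_eq t; have := steady_output_eq t.
have := steady_perc_value t => /=.
have P0 := @px t Price isT; have Y0 := @px t Output isT.
have D0 := @px t MultDemand isT; have O0 := @px t MultProd isT.
rewrite /Kf; move: D0 O0 P0 Y0.
case/andP: (gam_in01 e) => g0 g1; case/andP: (delta_in01 e) => d0 d1.
set U := xbar t MultPerc * _ / _.
move: U (xbar t Output) (xbar t Price) (xbar t MultDemand) (xbar t MultProd).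
move: (phi e m) (eps e) (gam e) (delta e) g0 g1 d0 d1.
move=> f ep g de g0 g1 d0 d1 U Y P D O D0 O0 P0 Y0 hU hP hY.
have gd : de * g < 1.
  by rewrite (le_lt_trans _ g1)// ler_piMl// ltW.
have gdn : 1 - de * g != 0 by rewrite gt_eqF// subr_gt0.
have UE : U = (ep - 1) * g * f * de * (D * Y / P) / (1 - de * g).
  by apply: (mulIf gdn); rewrite mulfVK// mulrBr mulr1 [X in X - _ = _]hU; ring.
have PE : P = D + O by lra.
have DO : 0 < D + O by rewrite addr_gt0.
rewrite UE PE in hY.
have H : (Y - ep * (D * Y / (D + O)) - (ep - 1) * g * (D * Y / (D + O) * f) +
  (1 - g) * ((ep - 1) * g * f * de * (D * Y / (D + O)) / (1 - de * g)))
   * ((D + O) / (Y * D)) = 0 by rewrite hY mul0r.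
apply/eqP; rewrite -subr_eq0 -H; apply/eqP.
by field; rewrite gdn !gt_eqF.
Qed.

Definition phillips_scale (t : int) : R :=
  xbar t MultDemand * xbar t Output / xbar t PercCost *
  (eps e - 1) * gam e * phi e m * sigma e m / (1 - gam e).

Lemma phillips_scale_neq0 t : phillips_scale t != 0.
Proof.
case/andP: (gam_in01 e) => g0 g1; have e1 := eps_gt1 e.
have [f0 s0 _ _] := phi_facts m_itv.
rewrite gt_eqF// divr_gt0 ?subr_gt0// !mulr_gt0 ?invr_gt0 ?subr_gt0//; exact: px.
Qed.

(** By the law of motion p' - c^p' = gam (p' - c^p), and p' - c^p is inflation plus the current
    perceived markup. *)
Lemma perceived_markup_next h (t : int) : static_equilibrium h t ->
  static_equilibrium h (t + 1) ->
  first_order xbar (inflation_identity (t + 1)) h = 0 ->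
  h (t + 1) PercMarkup = gam e * (h (t + 1) Inflation + h t PercMarkup).
Proof.
move=> S S'; rewrite first_order_inflation// addrK => hi.
have := static_law S'; rewrite addrK => hl.
have := static_perceived_markup S; have := static_perceived_markup S' => <- <-.
have -> : h (t + 1) Inflation = h (t + 1) Price - h t Price by lra.
by rewrite -hl; ring.
Qed.

(** A pathwise identity without expectations: the left side need not vanish on a given path, only
    its conditional expectation does. *)
Lemma perccost_phillips h (t : int) : static_equilibrium h t ->
  static_equilibrium h (t + 1) ->
  first_order xbar (inflation_identity (t + 1)) h = 0 ->
  first_order xbar (firm_foc e PercCost t) h = phillips_scale t *
   (- ((1 - delta e * gam e) * h t PercMarkup) + lambda1 e m * h t Labor
    + delta e * gam e * h (t + 1) Inflation - lambda2 e m * h (t + 1) Labor).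
Proof.
move=> S S' hi.
have mn := steady_markup st (t + 1); rewrite addrK -/m in mn.
have dn := steady_demand (t + 1); rewrite addrK in dn.
have ln' := steady_law st (t + 1); rewrite addrK in ln'.
rewrite first_order_perccost// mn// dn ln' static_demand_dev//.
have hl := static_law S'; rewrite addrK in hl.
rewrite hl.
have hp : gam e * (h (t + 1) Price - h t PercCost) = h (t + 1) PercMarkup.
  by rewrite -(static_perceived_markup S') -hl; ring.
rewrite hp (static_spending S) (static_spending S').
have [r1 rY rX r4 [rD rC]] := steady_ratios t.
have [p1 p2] := static_pricing S; have [p1' p2'] := static_pricing S'.
have D0 := lt0r_neq0 (@px t MultDemand isT).
have D0' := lt0r_neq0 (@px (t + 1) MultDemand isT).
have {}p2 : h t MultDemand - h t Price
    = - ((eps e - 1) * Kf * ((1 + Defs.eta e) * h t Labor)).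
  by apply: (mulfI D0); rewrite p2 -(steady_markup_ratio t); field.
have {}p2' : h (t + 1) MultDemand - h (t + 1) Price
    = - ((eps e - 1) * Kf * ((1 + Defs.eta e) * h (t + 1) Labor)).
  by apply: (mulfI D0'); rewrite p2' -(steady_markup_ratio (t + 1)); field.
(* The coefficients of the date t + 1 price condition are real ratios, hence equal to those of date
   t, as [phillips_algebra] requires. *)
rewrite rX -[xbar t MultPerc * _ / _]mulrA rC mulrA in p1'.
rewrite rY -[X in _ = X * _]mulrAC rD [X in _ = X * _]mulrAC in p1'.
have [f0 s0 _ _] := phi_facts m_itv.
have Q := phillips_algebra (gam_in01 e) (delta_in01 e) f0 s0 (eps_gt1 e)
  (steady_perc_value t) p2 p2' p1 p1' (perceived_markup_next S S' hi).
have C0 := lt0r_neq0 (@px t PercCost isT).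
have P0 := lt0r_neq0 (@px t Price isT).
have {}r1 : sdf e xbar t 1 * (xbar (t + 1) MultDemand * xbar (t + 1) Output / xbar t PercCost)
  = delta e * xbar t MultDemand * (xbar t Output / xbar t PercCost).
  by rewrite rY !mulrA r1.
have {}r4 : sdf e xbar t 1 * (xbar (t + 1) MultPerc * xbar (t + 1) PercCost / xbar t PercCost)
  = delta e * xbar t MultPerc.
  by rewrite rX [X in _ * (X / _)]mulrC !mulrA r4; field.
rewrite r1 r4 /lambda1 /lambda2 /phillips_scale.
move: Q; set T := (- ((1 - _ * _) * _) + _ + _ - _) => Q.
have e1 : 1 - gam e != 0 by case/andP: (gam_in01 e) => _ g1; rewrite gt_eqF// subr_gt0.
(* [phillips_algebra] works relative to P, the condition for C^p relative to C^p; P / C^p converts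
   between them. *)
transitivity (xbar t Price / xbar t PercCost * (xbar t MultDemand * xbar t Output / xbar t Price *
  (eps e - 1) * gam e * phi e m * sigma e m / (1 - gam e) * T)); last first.
  move: C0 P0 e1; generalize T (phi e m) (sigma e m) => T' f' s'.
  move: (xbar t PercCost) (xbar t Price) (xbar t MultDemand) (xbar t Output).
  by move=> C P D Y C0 P0 e1; field; rewrite C0 P0 e1.
rewrite -Q; move: C0 P0; generalize (phi e m) (sigma e m) => f' s'.
move: (xbar t PercCost) (xbar t Price) (xbar t MultDemand) (xbar t Output) (xbar t MultPerc).
move=> C P D Y X C0 P0.
move: (h t) (h (t + 1)) => a b.
by field; rewrite C0 P0.
Qed.

End Phillips.

(** * Taking conditional expectations *)

Section Stochastic.
Set Implicit Arguments.
Unset Strict Implicit.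
Context {R : realType} {d : measure_display} {Omega : measurableType d}.
Variables (Pr : probability Omega R) (e : economy R).
Variables (Fil : int -> set (set Omega)) (E : int -> (Omega -> R) -> Omega -> R).
Variables (pibar : R) (xbar : trajectory R) (x : process R Omega).
Hypotheses (HF : filtration Fil) (HE : conditional_expectations Pr Fil E).
Hypotheses (st : steady_state e pibar xbar) (mM : xbar 0 PercMarkup < Mh e).
Hypothesis adm : admissible Pr Fil xbar x.

Let px : positive xbar := steady_positive st.
Let h (w : Omega) : trajectory R := fun t v => deviation xbar x t v w.
Let sF t : sigma_algebra setT (Fil t). Proof. by case: HF. Qed.

Lemma deviation_adapted (s t : int) v : s <= t ->
  adapted Pr (Fil t) (fun w => h w s v).
Proof.
move=> sgt; apply: (adapted_le HF sgt); split; last first.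
  by case: adm => _ _ /(_ s v).
apply/(measurable_wrtE _ (sF s)); case: adm => _ /(_ s v) + _.
move/(measurable_wrtE _ (sF s)) => mx; rewrite /h /deviation.
case: (in_levels v); apply: measurable_realfun.measurable_funB => //.
by apply: measurableT_comp mx; exact: measurable_realfun.measurable_ln.
Qed.

Lemma adapted_add t X Y : adapted Pr (Fil t) X -> adapted Pr (Fil t) Y ->
  adapted Pr (Fil t) (fun w => X w + Y w).
Proof.
move=> aX aY; have := adapted_lin 1 1 (sF t) aX aY.
by congr (adapted _ _ _); apply/funext => w; rewrite !mul1r.
Qed.

Lemma adapted_scale t X (c : R) : adapted Pr (Fil t) X ->
  adapted Pr (Fil t) (fun w => c * X w).
Proof.
move=> aX; have := adapted_lin c 0 (sF t) aX aX.
by congr (adapted _ _ _); apply/funext => w; rewrite mul0r addr0.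
Qed.

Lemma adapted_opp t X : adapted Pr (Fil t) X -> adapted Pr (Fil t) (fun w => - X w).
Proof.
move=> aX; have := adapted_scale (-1) aX.
by congr (adapted _ _ _); apply/funext => w; rewrite mulN1r.
Qed.

(** Replaces an expansion by its explicit form, linear in the deviations, on which the closure
    lemmas act. *)
Lemma adapted_ext t X Y : (forall w, X w = Y w) -> adapted Pr (Fil t) Y ->
  adapted Pr (Fil t) X.
Proof. by move=> /funext ->. Qed.

Local Ltac adapted_tac := repeat first
  [ apply: deviation_adapted; by rewrite ?lerDl ?gerBl
  | refine (adapted_add _ _) | refine (adapted_opp _) | refine (adapted_scale _ _) ].

Lemma optimality_ae (t : int) g : loglinear_equilibrium_at Pr E e xbar x t ->
  optimality e t g -> adapted Pr (Fil t) (fun w => first_order xbar g (h w)) ->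
  {ae Pr, forall w, first_order xbar g (h w) = 0}.
Proof.
move=> [_ L] og ag; have := cond_exp_id HF HE ag; have := L _ og.
by apply: filterS2 => w <- ->.
Qed.

Lemma ae_conj (P Q : Omega -> Prop) : {ae Pr, forall w, P w} ->
  {ae Pr, forall w, Q w} -> {ae Pr, forall w, P w /\ Q w}.
Proof. by apply: filterS2. Qed.

Lemma static_equilibrium_ae (t : int) : loglinear_equilibrium_at Pr E e xbar x t ->
  {ae Pr, forall w, static_equilibrium e xbar (h w) t}.
Proof.
move=> L; have [Lid _] := L.
have mMt : demand_markup e (xbar t Price) (xbar (t - 1) PercCost) < Mh e.
  by rewrite (steady_markup st).
have m01 : measurable (`[0, 1] : set R) by [].
have s01 : `[0, 1] `<=` (`[0, 1] : set R) by [].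
have c1 := optimality_ae L (@opt_household R e t Labor isT)
  (adapted_ext (t := t) (fun w => first_order_labor e (h w) t px) ltac:(adapted_tac)).
have c2 := optimality_ae L (@opt_household R e t Wage isT)
  (adapted_ext (t := t) (fun w => first_order_wage e (h w) t px) ltac:(adapted_tac)).
have c3 := optimality_ae L (opt_purchase e t m01 s01)
  (adapted_ext (t := t) (fun w => first_order_purchase e (h w) t px) ltac:(adapted_tac)).
have c4 := optimality_ae L (@opt_firm R e t Output isT)
  (adapted_ext (t := t) (fun w => first_order_output e (h w) t px) ltac:(adapted_tac)).
have c5 := optimality_ae L (opt_hiring e t m01 s01)
  (adapted_ext (t := t) (fun w => first_order_hiring e (h w) t px) ltac:(adapted_tac)).
have c6 := optimality_ae L (@opt_firm R e t MultProd isT)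
  (adapted_ext (t := t) (fun w => first_order_prod e (h w) t px) ltac:(adapted_tac)).
have c7 := optimality_ae L (@opt_firm R e t MultPerc isT)
  (adapted_ext (t := t) (fun w => first_order_perc e (h w) t px) ltac:(adapted_tac)).
have c8 := optimality_ae L (@opt_firm R e t MultDemand isT)
  (adapted_ext (t := t) (fun w => first_order_demand (h w) px mMt)
    ltac:(rewrite /demand_dev; adapted_tac)).
have c9 := optimality_ae L (@opt_firm R e t Price isT)
  (adapted_ext (t := t) (fun w => first_order_price (h w) px mMt)
    ltac:(rewrite /demand_dev; adapted_tac)).
have i1 := Lid _ (id_perceived_markup e t).
have i2 := Lid _ (id_price_index e t).
have i3 := Lid _ (id_consumption e t).
have C := ae_conj c1 (ae_conj c2 (ae_conj c3 (ae_conj c4 (ae_conj c5 (ae_conj c6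
  (ae_conj c7 (ae_conj c8 (ae_conj c9 (ae_conj i1 (ae_conj i2 i3)))))))))).
by apply: filterS C => w [? [? [? [? [? [? [? [? [? [? [? ?]]]]]]]]]]]; split.
Qed.

Lemma perceived_markup_ae (t : int) : loglinear_equilibrium_at Pr E e xbar x t ->
  loglinear_equilibrium_at Pr E e xbar x (t + 1) ->
  {ae Pr, forall w, h w (t + 1) PercMarkup
     = gam e * (h w (t + 1) Inflation + h w t PercMarkup)}.
Proof.
move=> L L'; have [Lid _] := L'; have := Lid _ (id_inflation e (t + 1)).
move: (static_equilibrium_ae L) (static_equilibrium_ae L').
apply: filterS3 => w S S' I; exact: (perceived_markup_next st S S' I).
Qed.

Lemma phillips_ae (t : int) : loglinear_equilibrium_at Pr E e xbar x t ->
  loglinear_equilibrium_at Pr E e xbar x (t + 1) ->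
  {ae Pr, forall w,
    (1 - delta e * gam e) * h w t PercMarkup
     - lambda1 e (xbar 0 PercMarkup) * h w t Labor
    = delta e * gam e * E t (deviation xbar x (t + 1) Inflation) w
     - lambda2 e (xbar 0 PercMarkup) * E t (deviation xbar x (t + 1) Labor) w}.
Proof.
move=> L L'; have [Lid' _] := L'; have [_ Lo] := L.
have Hi := Lid' _ (id_inflation e (t + 1)).
pose c := phillips_scale e xbar t.
have c0 : c != 0 by exact: (phillips_scale_neq0 st mM).
pose l1 := lambda1 e (xbar 0 PercMarkup); pose l2 := lambda2 e (xbar 0 PercMarkup).
(* [A] is known at date t and passes through [E t] unchanged; [B] collects what is dated t + 1. *)
pose A w := - (1 - delta e * gam e) * h w t PercMarkup + l1 * h w t Labor.
pose B w := delta e * gam e * h w (t + 1) Inflation + - l2 * h w (t + 1) Labor.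
pose V w := first_order xbar (firm_foc e PercCost t) (h w).
have aA : adapted Pr (Fil t) A by adapted_tac.
have aI : adapted Pr (Fil (t + 1)) (fun w => h w (t + 1) Inflation) by adapted_tac.
have aN : adapted Pr (Fil (t + 1)) (fun w => h w (t + 1) Labor) by adapted_tac.
have aB : adapted Pr (Fil (t + 1)) B by adapted_tac.
(* Adaptedness at [t + 1] serves here to supply the integrability that [cond_exp_ae] asks for. *)
have aV : adapted Pr (Fil (t + 1)) V.
  have mMt : demand_markup e (xbar (t + 1) Price) (xbar t PercCost) < Mh e.
    by have := steady_markup st (t + 1); rewrite addrK => ->.
  apply: (adapted_ext (fun w => first_order_perccost (h w) px mMt)).
  by rewrite /demand_dev addrK; adapted_tac.
have VAB : {ae Pr, forall w, V w = c * A w + c * B w}.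
  move: Hi (static_equilibrium_ae L) (static_equilibrium_ae L').
  apply: filterS3 => w I S S'; rewrite /V (perccost_phillips st mM S S' I).
  by rewrite -mulrDr /c; congr (_ * _); rewrite /A /B /l1 /l2 mulNr !addrA !mulNr.
have e1 := cond_exp_ae HF HE t aV.2 (integrable_lin c c aA.2 aB.2) VAB.
have e2 := cond_exp_lin HF HE t c c aA.2 aB.2.
have e3 := cond_exp_id HF HE aA.
have e4 := cond_exp_lin HF HE t (delta e * gam e) (- l2) aI.2 aN.2.
have e5 := Lo _ (@opt_firm R e t PercCost isT).
near=> w.
have w1 : E t V w = E t (fun w => c * A w + c * B w) w by near: w.
have w2 : E t (fun w => c * A w + c * B w) w = c * E t A w + c * E t B w by near: w.
have w3 : E t A w = A w by near: w.
have w4 : E t B w = delta e * gam e * E t (deviation xbar x (t + 1) Inflation) w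
   + - l2 * E t (deviation xbar x (t + 1) Labor) w by near: w.
have w5 : E t V w = 0 by near: w.
move: w5; rewrite w1 w2 w3 w4 -mulrDr => /eqP; rewrite mulf_eq0 (negbTE c0) /=.
move=> /eqP; rewrite /A -/l1 -/l2.
generalize (E t (deviation xbar x (t + 1) Inflation) w)
  (E t (deviation xbar x (t + 1) Labor) w) => EI EN; lra.
Unshelve. all: by end_near. Qed.

Lemma discounted_inflation_cvg (mp infl : int -> R) (t : int) (g b : R) :
  0 < g < 1 -> (forall s, `|mp s| <= b) ->
  (forall k : nat, mp (t - k%:Z) = g * (infl (t - k%:Z) + mp (t - k%:Z - 1))) ->
  series (fun s : nat => g ^+ s.+1 * infl (t - s%:Z)) @ \oo --> mp t.
Proof.
move=> /andP[g0 g1] mpb rec.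
(* The recursion telescopes, and the remainder is at most [g ^+ n * b] in absolute value. *)
have sE n : series (fun s : nat => g ^+ s.+1 * infl (t - s%:Z)) n
    = mp t - g ^+ n * mp (t - n%:Z).
  elim: n => [|n IH].
    by rewrite /series /= big_geq// expr0 mul1r subr0 subrr.
  rewrite seriesSr IH rec.
  have -> : t - n.+1%:Z = t - n%:Z - 1 by rewrite intS; ring.
  by rewrite exprSr; ring.
rewrite (funext sE) -[X in _ --> X]subr0.
apply: cvgB; first exact: cvg_cst.
have gc : g ^+ n * b @[n --> \oo] --> 0.
  rewrite -[X in _ --> X](mul0r b); apply: cvgMl.
  by apply: cvg_expr; rewrite gtr0_norm.
apply/norm_cvg0P; apply: squeeze_cvgr gc; last first.
  exact: cvg_cst.
near=> n; have gn : 0 <= g ^+ n by rewrite exprn_ge0// ltW.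
by rewrite normr_ge0 normrM ger0_norm//= ler_wpM2l.
Unshelve. all: by end_near. Qed.

End Stochastic.

Theorem proposition2 (R : realType) (e : economy R)
    (d : measure_display) (Omega : measurableType d) (Pr : probability Omega R)
    (Fil : int -> set (set Omega)) (E : int -> (Omega -> R) -> Omega -> R)
    (pibar : R) (xbar : trajectory R) (x : process R Omega) :
  filtration Fil ->
  conditional_expectations Pr Fil E ->
  steady_state e pibar xbar ->
  xbar 0 PercMarkup < Mh e ->
  admissible Pr Fil xbar x ->
  let mp := fun t => deviation xbar x t PercMarkup in
  let n := fun t => deviation xbar x t Labor in
  let infl := fun t => deviation xbar x t Inflation in
  let l1 := lambda1 e (xbar 0 PercMarkup) in
  let l2 := lambda2 e (xbar 0 PercMarkup) in
  (forall t0 : int,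
     (forall t, t0 <= t -> loglinear_equilibrium_at Pr E e xbar x t) ->
     forall t, t0 <= t ->
       {ae Pr, forall w,
          (1 - delta e * gam e) * mp t w - l1 * n t w
          = delta e * gam e * E t (infl (t + 1)) w - l2 * E t (n (t + 1)) w})
  /\
  ((forall t, loglinear_equilibrium_at Pr E e xbar x t) ->
   {ae Pr, forall w, exists b : R, forall t, `|mp t w| <= b} ->
   forall t,
     {ae Pr, forall w,
        let sum := series (fun s : nat => gam e ^+ s.+1 * infl (t - s%:Z) w) in
        cvgn sum /\
        (1 - delta e * gam e) * limn sum - l1 * n t w
        = delta e * gam e * E t (infl (t + 1)) w - l2 * E t (n (t + 1)) w}).
Proof.
move=> HF HE st mM adm mp n infl l1 l2; split=> [t0 L t t0t|L Hb t].
  (* Variables of date [t - 1] occur, but only the equilibrium conditions of [t] and [t + 1] are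
     invoked, so the economy may start at [t0]. *)
  have tt1 : t0 <= t + 1 by rewrite (le_trans t0t)// lerDl.
  exact: (phillips_ae HF HE st mM adm (L _ t0t) (L _ tt1)).
have rec : {ae Pr, forall w, forall k : nat,
    mp (t - k%:Z) w = gam e * (infl (t - k%:Z) w + mp (t - k%:Z - 1) w)}.
  (* The lags are countably many, so one null set serves all of them and the recursion can be
     iterated along a fixed path, with a bound that may depend on the path. *)
  apply/ae_foralln => k.
  have := perceived_markup_ae HF HE st mM adm (L (t - k%:Z - 1)) (L (t - k%:Z - 1 + 1)).
  by rewrite subrK.
move: (phillips_ae HF HE st mM adm (L t) (L (t + 1))) Hb rec.
apply: filterS3 => w ph [b hb] hr.
have cv := @discounted_inflation_cvg _ _ (infl^~ w) _ _ _ (gam_in01 e) hb hr.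
by split; [apply/cvg_ex; exists (mp t w)|rewrite (cvg_lim _ cv)].
Qed.
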